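(* Let $\lambda$ be the max-min EL-labeling of the partition lattice $\Pi_{n+1}$. Then the map $c:(PT(n),\preceq)\to(\Pi_{n+1})_\lambda(2)$ is a poset isomorphism onto the maximal chain descent order. Moreover, the cover relations of $(PT(n),\preceq)$ are precisely given by $T\rightharpoonup S$ for $S,T\in PT(n)$.
   Context: $\Pi_{n+1}$ is the lattice of set partitions of $[n+1]=\{1,\dots,n+1\}$ ordered by refinement, with least element $1|2|\cdots|n+1$. If $x\lessdot y$, then $y$ is obtained by merging two blocks $B_1,B_2$ of $x$, and the max-min EL-labeling is $\lambda(x,y)=\max\{\min B_1,\min B_2\}$. $PT(n)$ is the set of rooted, unordered, decreasing, full binary trees with $2n$ edges, with vertices labeled (bijectively) by $\{1,\dots,2n+1\}$ and leaf set $\{1,\dots,n+1\}$. Full binary: each non-leaf vertex has exactly two children. Decreasing: all descendants of a vertex have smaller labels than it. Unordered: the two children of a vertex are not ordered. For a vertex labeled $i$ of $T$, $T^i$ is the full subtree of $T$ rooted at $i$; if $i$ is internal, $T^i_1,T^i_2$ are the full subtrees rooted at its two children; $L(\cdot)$ denotes the set of leaf labels. For $T\in PT(n)$, $c(T):x_0\lessdot x_1\lessdot\dots\lessdot x_n$ is the maximal chain of $\Pi_{n+1}$ in which the blocks of $x_i$ are the leaf sets of the components of $T$ restricted to the vertices labeled at most $n+1+i$. For $T,S\in PT(n)$ write $T\rightharpoonup S$ if for some $1\le i\le n-1$: either (i) $S$ is obtained from $T$ by swapping the labels $n+1+i$ and $n+1+i+1$, or (ii) $n+1+i$ is a child of $n+1+i+1$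 in $T$ and $S$ is obtained from $T$ by swapping the full subtree whose root is the child of $n+1+i+1$ other than $n+1+i$ with a full subtree whose root is a child of $n+1+i$; and moreover $\max\{\min L(T^{n+1+i}_1),\min L(T^{n+1+i}_2)\}<\max\{\min L(T^{n+1+i+1}_1),\min L(T^{n+1+i+1}_2)\}$. The partial order $\preceq$ on $PT(n)$ is the reflexive, transitive closure of $\rightharpoonup$. For a finite poset $P$ with least element $\hat 0$ and greatest element $\hat 1$, $\mathcal M(P)$ is the set of maximal chains. For a chain $d$ and $x\in d$ write $d^x=\{w\in d: w\le x\}$, $d_x=\{w\in d: w\ge x\}$. A saturated chain gets the sequence of labels of its edges from bottom to top; it is ascending if this sequence is weakly increasing. An EL-labeling is a labeling of cover relations such that for every $x<y$ the interval $[x,y]$ has a unique ascending maximal chain and it lexicographically precedes all other maximal chains of $[x,y]$. A saturated chain $u\lessdot v\lessdot w$ is a descent if $\lambda(u,v)\not\le\lambda(v,w)$. Polygon move: $m\to m'$ if there are $x<z$ in $m\cap m'$ with $m^x=m'^x$, $m_z=m'_z$, such that $m'\cap[x,z]$ is a descent $x\lessdot y\lessdot z$ with $y\notin m$, while $m\cap[x,z]$ is the unique ascending maximal chain of $[x,z]$. The maximal chain descent order $P_\lambda(2)$ is $\mathcal M(P)$ partially ordered by the reflexive and transitive closure of $\to$. *)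

(* Defs.v *)
From HB Require Import structures.
From mathcomp Require Import all_boot all_order all_fingroup.

Set Implicit Arguments.
Unset Strict Implicit.
Unset Printing Implicit Defensive.

Import Order.Theory.

(* The set [N] = {1, ..., N} is represented by 'I_N, the ordinal of value k   *)
(* standing for the element k + 1.                                            *)
Definition label N (v : 'I_N) : nat := v.+1.

(* For nonempty A the default value N is harmless, as every label is <= N.    *)
Definition min_label N (A : {set 'I_N}) : nat :=
  \big[minn/N]_(v in A) label v.

Definition covers (T : finType) (le : rel T) (x y : T) : bool :=
  [&& x != y, le x y &
      [forall z, le x z && le z y ==> (z == x) || (z == y)]].

Definition partial_order (T : Type) (le : rel T) : Prop :=
  [/\ reflexive le, antisymmetric le & transitive le].

Definition poset_isomorphism (A B : Type) (leA : rel A) (leB : rel B)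
    (f : A -> B) : Prop :=
  [/\ partial_order leA, partial_order leB, bijective f &
      forall x y, leB (f x) (f y) = leA x y].

Definition is_chain d (P : finPOrderType d) (c : {set P}) : bool :=
  [forall x in c, forall y in c, (x >=< y)%O].

Record max_chain d (P : finTBPOrderType d) := MaxChain {
  chain_set :> {set P};
  _ : maxset (@is_chain d P) chain_set }.

HB.instance Definition _ d (P : finTBPOrderType d) :=
  [isSub for @chain_set d P].
HB.instance Definition _ d (P : finTBPOrderType d) :=
  [Finite of max_chain P by <:].

Section DescentOrder.

(* Only the values of lam on cover relations are used.                        *)
Context d (P : finTBPOrderType d) dL (L : porderType dL) (lam : P -> P -> L).

Definition interval (x z : P) : {set P} := [set w | (x <= w <= z)%O].

Definition chain_below (c : {set P}) (x : P) : {set P} :=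
  [set w in c | (w <= x)%O].

Definition chain_above (c : {set P}) (x : P) : {set P} :=
  [set w in c | (x <= w)%O].

(* The labels of the edges of a saturated chain, from bottom to top; sorting  *)
(* the elements of a chain lists them in increasing order.                    *)
Definition chain_labels (c : {set P}) : seq L :=
  if sort <=%O (enum c) is x :: s then pairmap lam x s else [::].

Definition ascending (c : {set P}) : bool := sorted <=%O (chain_labels c).

Definition max_chain_of_interval (x z : P) (c : {set P}) : bool :=
  maxset (fun c' : {set P} => is_chain c' && (c' \subset interval x z)) c.

Definition unique_ascending (x z : P) (c : {set P}) : bool :=
  [&& max_chain_of_interval x z c, ascending c &
      [forall c' : {set P},
         max_chain_of_interval x z c' && ascending c' ==> (c' == c)]].

Definition descent (u v w : P) : bool :=
  [&& covers <=%O u v, covers <=%O v w & ~~ (lam u v <= lam v w)%O].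

Definition polygon_move (m m' : max_chain P) : bool :=
  [exists x : P, exists z : P,
     [&& (x < z)%O, x \in m :&: m', z \in m :&: m',
         chain_below m x == chain_below m' x,
         chain_above m z == chain_above m' z,
         [exists y : P, [&& m' :&: interval x z == [set x; y; z],
                            descent x y z & y \notin m]] &
         unique_ascending x z (m :&: interval x z)]].

Definition descent_order : rel (max_chain P) := connect polygon_move.

End DescentOrder.

Record set_partition (T : finType) := SetPartition {
  blocks :> {set {set T}};
  blocksP : partition blocks [set: T] }.

HB.instance Definition _ (T : finType) := [isSub for @blocks T].
HB.instance Definition _ (T : finType) := [Finite of set_partition T by <:].

Section Refinement.

Context (T : finType).
Implicit Types x y z : set_partition T.

Definition refines x y : bool :=
  [forall B in blocks x, exists C in blocks y, B \subset C].

Lemma refinesP x y :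
  reflect (forall B, B \in blocks x -> exists2 C, C \in blocks y & B \subset C)
          (refines x y).
Proof.
apply: (iffP forall_inP) => h B /h; first by case/exists_inP => C; exists C.
by case=> C Cy BC; apply/exists_inP; exists C.
Qed.

Lemma refines_refl : reflexive refines.
Proof. by move=> x; apply/refinesP => B Bx; exists B. Qed.

Lemma refines_trans : transitive refines.
Proof.
move=> y x z /refinesP xy /refinesP yz; apply/refinesP => B /xy [C /yz [D Dz CD] BC].
by exists D => //; apply: subset_trans CD.
Qed.

Lemma refines_sub x y : refines x y -> refines y x -> blocks x \subset blocks y.
Proof.
move=> /refinesP xy /refinesP yx; apply/subsetP => B Bx.
have [C Cy BC] := xy B Bx; have [D Dx CD] := yx C Cy.
have /and3P [_ /trivIsetP tr n0] := blocksP x.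
have BD : B = D.
  apply/eqP; apply: contraT => /(tr B D Bx Dx) dBD.
  have /set0Pn [b bB] : B != set0 by apply: contraNneq n0 => <-.
  have bD : b \in D by apply: (subsetP CD); apply: (subsetP BC).
  by rewrite (disjointFr dBD bB) in bD.
suff -> : B = C by [].
by apply/eqP; rewrite eqEsubset BC BD CD.
Qed.

Lemma refines_anti : antisymmetric refines.
Proof.
move=> x y /andP[xy yx]; apply: val_inj; apply/eqP.
by rewrite eqEsubset /= !refines_sub.
Qed.

Lemma discrete_subproof :
  partition (equivalence_partition (@eq_op T) [set: T]) [set: T].
Proof.
by apply: equivalence_partitionP => x y z _ _ _; split=> // /eqP ->.
Qed.

Lemma indiscrete_subproof :
  partition (equivalence_partition (fun _ _ : T => true) [set: T]) [set: T].
Proof. exact: equivalence_partitionP. Qed.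

Definition discrete : set_partition T := SetPartition discrete_subproof.
Definition indiscrete : set_partition T := SetPartition indiscrete_subproof.

Lemma refines_discrete x : refines discrete x.
Proof.
have /and3P [/eqP cov _ _] := blocksP x.
apply/refinesP => _ /imsetP [a _ ->].
have : a \in cover x by rewrite cov inE.
case/bigcupP => B Bx aB; exists B => //.
by apply/subsetP => b; rewrite !inE => /eqP <-.
Qed.

Lemma refines_indiscrete x : refines x indiscrete.
Proof.
have /and3P [_ _ n0] := blocksP x.
apply/refinesP => B Bx.
have /set0Pn [b _] : B != set0 by apply: contraNneq n0 => <-.
exists [set: T]; last exact: subsetT.
by apply/imsetP; exists b => //; apply/setP => a; rewrite !inE.
Qed.

End Refinement.

Fact refinement_display : Order.disp_t. Proof. exact: Order.Disp tt tt. Qed.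

HB.instance Definition _ (T : finType) :=
  Order.Le_isPOrder.Build refinement_display (set_partition T)
    (@refines_refl T) (@refines_anti T) (@refines_trans T).
HB.instance Definition _ (T : finType) :=
  Order.hasBottom.Build refinement_display (set_partition T)
    (@refines_discrete T).
HB.instance Definition _ (T : finType) :=
  Order.hasTop.Build refinement_display (set_partition T)
    (@refines_indiscrete T).

(* When y merges the blocks B1 and B2 of x, blocks x :\: blocks y is          *)
(* [set B1; B2], so this is max (min B1) (min B2).                            *)
Definition max_min N (x y : set_partition 'I_N) : nat :=
  \max_(B in blocks x :\: blocks y) min_label B.

(* A rooted unordered tree on V is given by the partial function sending      *)
(* each vertex other than the root to its parent.                             *)
Section Trees.

Context (V : finType).
Implicit Types p : {ffun V -> option V}.

Definition children p (u : V) : {set V} := [set v | p v == Some u].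

Definition is_leaf p (u : V) : bool := children p u == set0.

(* v is u or a descendant of u, i.e. v is a vertex of the full subtree at u   *)
Definition in_subtree p (u v : V) : bool :=
  connect (fun a b => p b == Some a) u v.

Definition leaves p (u : V) : {set V} := [set v | is_leaf p v & in_subtree p u v].

Definition rooted_tree p : bool :=
  [exists r, (p r == None) && [forall v, in_subtree p r v]].

Definition full_binary p : bool :=
  [forall u, ~~ is_leaf p u ==> (#|children p u| == 2)].

Definition swap_labels p (a b : V) : {ffun V -> option V} :=
  [ffun v => omap (tperm a b) (p (tperm a b v))].

(* The full subtrees rooted at w and z trade places: w and z exchange their   *)
(* parents. Meaningful when neither vertex is a descendant of the other.      *)
Definition swap_subtrees p (w z : V) : {ffun V -> option V} :=
  [ffun v => p (tperm w z v)].

End Trees.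

Definition decreasing N (p : {ffun 'I_N -> option 'I_N}) : bool :=
  [forall u, forall v, in_subtree p u v && (v != u) ==> (label v < label u)].

(* Vertices are identified with their labels in {1, ..., 2n+1}.               *)
Record PT (n : nat) := PTree {
  parent :> {ffun 'I_(n.*2.+1) -> option 'I_(n.*2.+1)};
  _ : [&& rooted_tree parent, full_binary parent, decreasing parent &
          [forall v, is_leaf parent v == (label v <= n.+1)]] }.

HB.instance Definition _ n := [isSub for @parent n].
HB.instance Definition _ n := [Finite of PT n by <:].

Definition max_min_leaves n (T : PT n) (u : 'I_(n.*2.+1)) : nat :=
  \max_(v in children T u) min_label (leaves T v).

Definition tree_move n (T S : PT n) : bool :=
  [exists i : 'I_n, exists a : 'I_(n.*2.+1), exists b : 'I_(n.*2.+1),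
    [&& 1 <= i <= n - 1, label a == n + 1 + i, label b == n + 1 + i + 1,
        (parent S == swap_labels T a b)
        || (a \in children T b) &&
           [exists w in children T b :\ a, exists z in children T a,
              parent S == swap_subtrees T w z] &
        max_min_leaves T a < max_min_leaves T b]].

Definition PT_order n : rel (PT n) := connect (@tree_move n).

Lemma leaf_vertex_subproof n : n.+1 <= n.*2.+1.
Proof. by rewrite ltnS -addnn leq_addr. Qed.

Definition leaf_vertex n (j : 'I_n.+1) : 'I_(n.*2.+1) :=
  widen_ord (leaf_vertex_subproof n) j.

Definition restricted_edge n (T : PT n) (k : nat) : rel 'I_(n.*2.+1) :=
  fun u v => [&& label u <= k, label v <= k &
                 (parent T u == Some v) || (parent T v == Some u)].

Definition component_leaves n (T : PT n) (k : nat) (v : 'I_(n.*2.+1)) :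
    {set 'I_n.+1} :=
  [set j | connect (restricted_edge T k) v (leaf_vertex j)].

Definition chain_blocks n (T : PT n) (i : nat) : {set {set 'I_n.+1}} :=
  [set component_leaves T (n + 1 + i) v |
     v : 'I_(n.*2.+1) & label v <= n + 1 + i].

(* The chain x_0, ..., x_n as a set of partitions: x_i has the leaf sets of   *)
(* the components of T restricted to the labels <= n+1+i as blocks.           *)
Definition tree_chain n (T : PT n) : {set set_partition 'I_n.+1} :=
  [set x | [exists i : 'I_n.+1, blocks x == chain_blocks T i]].

(* Main.v *)
Require Import Defs.
From mathcomp Require Import all_boot all_order.
From mathcomp Require Import all_fingroup zify.
Set Implicit Arguments.
Unset Strict Implicit.
Unset Printing Implicit Defensive.
Import Order.Theory.

(** A tree and a maximal chain carry the same information. Read in increasing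
    order, the internal vertices of a tree merge two blocks at a time. In the
    resulting sequence of partitions a vertex is the block born at its stage, and
    its parent is the vertex at whose stage that block is merged into a larger
    one. Reading a sequence in this way always gives a tree, so trees and maximal
    chains are in bijection ([chain_of_tree_inj], [chain_of_tree_surj]).

    A polygon move changes a chain at one rank, inside an interval [x, z] of rank
    two. A merge removes one element from the set of block minima, the one named
    by its label. So every maximal chain of [x, z] has the same two distinct labels
    ([label_swap]), and they increase along exactly one of them, whose uniqueness is
    [ascending_unique]. A polygon move is thus a change at one rank, starting from
    a chain whose two labels around that rank increase ([polygon_moveP]).

    The middle elements of [x, z] are explicit. Either two disjoint pairs of blocks
    are merged independently, and the other middle element amounts to exchanging
    the labels of two consecutive vertices of the tree ([swap_disjoint]); or three
    blocks become one, and each of the two other middle elements amounts to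
    exchanging two full subtrees ([swap_nested]). These are the two kinds of tree
    moves, and the label conditions agree because a label of the chain is the
    maximum over the two children of the minimal leaf. Hence the bijection
    identifies tree moves with polygon moves ([tree_moveP], [polygon_tree_move]).

    A move exchanges two adjacent increasing entries of the word of labels and so
    creates exactly one inversion ([inversions_move]). A relation that raises a
    rank by one has no cycles, and its closure has that relation as its covers
    ([graded_partial_order], [graded_covers]). *)

(** * Set partitions under refinement *)

Section SetPartitions.
Context (T : finType).
Implicit Types (x y z : set_partition T) (A B C D E : {set T}) (a : T).

Lemma block_eq x B C a : B \in blocks x -> C \in blocks x ->
  a \in B -> a \in C -> B = C.
Proof.
move=> Bx Cx aB aC; have /and3P [_ /trivIsetP tr _] := blocksP x.
apply/eqP; apply: contraT => /(tr B C Bx Cx) dBC.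
by rewrite (disjointFr dBC aB) in aC.
Qed.

Lemma block_ex x a : exists2 B, B \in blocks x & a \in B.
Proof.
have /and3P [/eqP cov _ _] := blocksP x.
have : a \in cover x by rewrite cov inE.
by case/bigcupP => B; exists B.
Qed.

Lemma block_mem x B : B \in blocks x -> exists a, a \in B.
Proof.
move=> Bx; have /and3P [_ _ n0] := blocksP x.
by apply/set0Pn; apply: contraNneq n0 => <-.
Qed.

Lemma block_sub x B C : B \in blocks x -> C \in blocks x -> B \subset C -> B = C.
Proof.
move=> Bx Cx BC; have [a aB] := block_mem Bx.
by apply: (block_eq Bx Cx aB); apply: (subsetP BC).
Qed.

Lemma block_subU x B C D : B \in blocks x -> C \in blocks x -> D \in blocks x ->
  B \subset C :|: D -> B = C \/ B = D.
Proof.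
move=> Bx Cx Dx BCD; have [a aB] := block_mem Bx.
have := subsetP BCD a aB; rewrite inE => /orP [aC|aD]; [left|right].
  exact: (block_eq Bx Cx aB aC).
exact: (block_eq Bx Dx aB aD).
Qed.

Lemma leP_blocks x y :
  reflect (forall B, B \in blocks x -> exists2 C, C \in blocks y & B \subset C)
    (x <= y)%O.
Proof. exact: refinesP. Qed.

Lemma le_block_sub x y B C a : (x <= y)%O -> B \in blocks x -> C \in blocks y ->
  a \in B -> a \in C -> B \subset C.
Proof.
move=> /leP_blocks xy Bx Cy aB aC; have [D Dy BD] := xy B Bx.
by rewrite (block_eq Cy Dy aC (subsetP BD _ aB)).
Qed.

Lemma le_card x y : (x <= y)%O -> #|blocks y| <= #|blocks x|.
Proof.
move=> xy.
have h B : B \in blocks x -> exists C, (C \in blocks y) && (B \subset C).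
  by move/leP_blocks: xy => h /h [C Cy BC]; exists C; rewrite Cy.
pose f B := odflt set0 [pick C | (C \in blocks y) && (B \subset C)].
apply: leq_trans (leq_imset_card f (blocks x)); apply: subset_leq_card.
apply/subsetP => C Cy; have [a aC] := block_mem Cy.
have [B Bx aB] := block_ex x a; apply/imsetP; exists B => //.
rewrite /f; case: pickP => [D /andP [Dy BD]|] /=.
  exact: (block_eq Cy Dy aC (subsetP BD _ aB)).
by have [D /[swap] ->] := h _ Bx.
Qed.

Lemma card_blocks_gt0 x a : 0 < #|blocks x|.
Proof. by have [B Bx _] := block_ex x a; apply/card_gt0P; exists B. Qed.

Definition merges x y B C :=
  [/\ B \in blocks x, C \in blocks x, B != C &
      blocks y = (B :|: C) |: (blocks x :\: [set B; C])].

Lemma merges_sym x y B C : merges x y B C -> merges x y C B.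
Proof.
case=> Bx Cx BC e; split=> //; first by rewrite eq_sym.
by rewrite e (setUC C) (setUC [set C]).
Qed.

Lemma merge_ex x B C : B \in blocks x -> C \in blocks x -> B != C ->
  exists y, merges x y B C.
Proof.
move=> Bx Cx BC.
suff p : partition ((B :|: C) |: (blocks x :\: [set B; C])) [set: T].
  by exists (SetPartition p).
apply/and3P; split.
- apply/eqP/setP => a; rewrite [RHS]inE; apply/bigcupP.
  have [D Dx aD] := block_ex x a.
  have [DBC|DBC] := boolP (D \in [set B; C]).
    exists (B :|: C); first exact: setU11.
    by move: DBC aD; rewrite !inE => /orP [] /eqP -> ->; rewrite ?orbT.
  by exists D => //; rewrite 2!inE in_setD DBC Dx orbT.
- have aux D : D \in blocks x :\: [set B; C] -> [disjoint (B :|: C) & D].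
    rewrite !inE negb_or => /andP [/andP [DB DC] Dx].
    rewrite -setI_eq0; apply/eqP/setP => a; rewrite !inE.
    apply/negP => /andP [/orP [aB|aC] aD].
      by rewrite (block_eq Dx Bx aD aB) eqxx in DB.
    by rewrite (block_eq Dx Cx aD aC) eqxx in DC.
  have /and3P [_ /trivIsetP tr _] := blocksP x.
  apply/trivIsetP => D E /setU1P [->|Dx] /setU1P [->|Ex]; rewrite ?eqxx // => DE.
  + exact: aux.
  + by rewrite disjoint_sym; apply: aux.
  + by case/setDP: Dx => Dx _; case/setDP: Ex => Ex _; apply: tr.
- have [a aB] := block_mem Bx.
  apply/negP => /setU1P [/setP /(_ a)|/setDP [x0 _]]; first by rewrite !inE aB.
  by have /and3P [_ _ /negP] := blocksP x.
Qed.

Section Merges.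
Context (x y : set_partition T) (B C : {set T}) (m : merges x y B C).

Lemma mergesU_notin : B :|: C \notin blocks x.
Proof.
case: m => Bx Cx BC _; apply/negP => BCx; case/negP: BC; apply/eqP.
rewrite (block_sub Bx BCx (subsetUl _ _)).
by rewrite -(block_sub Cx BCx (subsetUr _ _)).
Qed.

Lemma merges_in D : (D \in blocks y) =
  (D == B :|: C) || [&& D != B, D != C & D \in blocks x].
Proof. by case: m => _ _ _ ->; rewrite !inE negb_or -andbA. Qed.

Lemma merges_new : B :|: C \in blocks y.
Proof. by rewrite merges_in eqxx. Qed.

Lemma merges_le : (x <= y)%O.
Proof.
apply/leP_blocks => D Dx; have [/eqP ->|DB] := boolP (D == B).
  by exists (B :|: C); [exact: merges_new|exact: subsetUl].
have [/eqP ->|DC] := boolP (D == C).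
  by exists (B :|: C); [exact: merges_new|exact: subsetUr].
by exists D => //; rewrite merges_in DB DC Dx orbT.
Qed.

Lemma merges_dead : blocks x :\: blocks y = [set B; C].
Proof.
case: (m) => Bx Cx _ _; apply/setP => D; rewrite !inE merges_in.
have [->|DB] := eqVneq D B.
  by rewrite Bx /= orbF andbT; apply: contraNneq mergesU_notin => <-.
have [->|DC] := eqVneq D C.
  by rewrite Cx /= orbF andbT; apply: contraNneq mergesU_notin => <-.
by rewrite /= negb_or -andbA andNb andbF.
Qed.

Lemma merges_born : blocks y :\: blocks x = [set B :|: C].
Proof.
apply/setP => D; rewrite !inE merges_in.
have [->|DB] := eqVneq D (B :|: C); first by rewrite mergesU_notin.
by rewrite /= !andbA andbC !andbA andbN.
Qed.

Lemma merges_card : #|blocks x| = #|blocks y|.+1.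
Proof.
case: (m) => Bx Cx BC ey.
have e2 : [set B; C] \subset blocks x.
  by apply/subsetP => D; rewrite !inE => /orP [] /eqP ->.
rewrite ey cardsU1 !inE (negbTE mergesU_notin) andbF /=.
rewrite cardsD (setIidPr e2) cards2 BC.
by have := subset_leq_card e2; rewrite cards2 BC /=; case: #|_| => [|[|k]] // _; rewrite add1n !subSS subn0.
Qed.

End Merges.

(** Below any strictly coarser partition there is room for one merge. This is
    the only source of covers, and it makes the number of blocks a rank. *)
Lemma lt_merges x y : (x < y)%O ->
  exists B C u, merges x u B C /\ (u <= y)%O.
Proof.
rewrite lt_neqAle => /andP [nxy xy].
have [B Bx [C Cx [D Dy /and3P [BC BD CD]]]] : exists2 B, B \in blocks x &
    exists2 C, C \in blocks x & exists2 D, D \in blocks y &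
      [&& B != C, B \subset D & C \subset D].
  have [/existsP [B /existsP [C /existsP [D]]]|no] := boolP [exists B, exists C, exists D,
     [&& B \in blocks x, C \in blocks x, D \in blocks y, B != C, B \subset D & C \subset D]].
    by case/and4P => Bx Cx Dy h; exists B => //; exists C => //; exists D.
  case/negP: nxy; rewrite eq_le xy; apply/leP_blocks => D Dy.
  have [a aD] := block_mem Dy; have [B Bx aB] := block_ex x a.
  exists B => //; apply/subsetP => c cD; have [C Cx cC] := block_ex x c.
  have [<- //|BC] := eqVneq C B.
  case/negP: no; apply/existsP; exists B; apply/existsP; exists C; apply/existsP; exists D.
  by rewrite Bx Cx Dy eq_sym BC (le_block_sub xy Bx Dy aB aD) (le_block_sub xy Cx Dy cC cD).
have [u mu] := merge_ex Bx Cx BC; exists B, C, u; split=> //.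
apply/leP_blocks => E; rewrite (merges_in mu) => /orP [/eqP ->|/and3P [_ _ Ex]].
  by exists D => //; rewrite subUset BD.
by move/leP_blocks: xy; apply.
Qed.

Lemma lt_card x y : (x < y)%O -> #|blocks y| < #|blocks x|.
Proof. by case/lt_merges => B [C [u [mu /le_card]]]; rewrite (merges_card mu). Qed.

Lemma le_card_eq x y : (x <= y)%O -> #|blocks x| = #|blocks y| -> x = y.
Proof. by rewrite le_eqVlt => /orP [/eqP //|/lt_card]; lia. Qed.

Definition step x y := (x <= y)%O && (#|blocks x| == #|blocks y|.+1).

Lemma step_lt x y : step x y -> (x < y)%O.
Proof.
by case/andP => xy /eqP c; rewrite lt_neqAle xy andbT; apply/eqP => e; rewrite e in c; lia.
Qed.

Lemma merges_step x y B C : merges x y B C -> step x y.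
Proof. by move=> m; rewrite /step (merges_le m) (merges_card m) eqxx. Qed.

Lemma step_merges x y : step x y -> exists B C, merges x y B C.
Proof.
move=> s; have [B [C [u [mu uy]]]] := lt_merges (step_lt s); exists B, C.
suff <- : u = y by [].
by apply: (le_card_eq uy); case/andP: s; rewrite (merges_card mu) => _ /eqP [].
Qed.

Lemma step_between x y u : step x y -> (x <= u)%O -> (u <= y)%O -> u = x \/ u = y.
Proof.
case/andP => _ /eqP c xu uy.
have := le_card xu; have := le_card uy; rewrite c leq_eqVlt => /orP [/eqP e|l1].
  by move=> _; right; apply: le_card_eq.
by move=> l2; left; apply/esym/le_card_eq => //; lia.
Qed.

Lemma covers_step x y : covers <=%O x y = step x y.
Proof.
apply/idP/idP => [/and3P [nxy xy /forallP no]|s].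
  have [B [C [u [mu uy]]]] : exists B C u, merges x u B C /\ (u <= y)%O.
    by apply: lt_merges; rewrite lt_neqAle nxy.
  have := no u; rewrite (merges_le mu) uy /= => /orP [] /eqP e.
    by have := merges_card mu; rewrite e; lia.
  by rewrite -e (merges_step mu).
have := step_lt s; rewrite lt_neqAle => /andP [nxy xy].
apply/and3P; split=> //; apply/forallP => u; apply/implyP => /andP [xu uy].
by have [->|->] := step_between s xu uy; rewrite eqxx ?orbT.
Qed.


(** A rank two interval merges either two disjoint pairs of blocks or three
    blocks into one. The four lemmas below list its middle elements: first
    that the other orders of merging do end at z, then that there is no other
    middle element. The disjoint shape is recognised by the block born at the
    first step being still alive at the end. *)
Lemma diamond_disjoint x y y' z B1 B2 C1 C2 :
  merges x y B1 B2 -> merges y z C1 C2 -> B1 :|: B2 \in blocks z ->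
  merges x y' C1 C2 -> merges y' z B1 B2.
Proof.
move=> m1 m2 Bz m3.
have B12 : (B1 :|: B2 != C1) /\ (B1 :|: B2 != C2).
  move: Bz; rewrite (merges_in m2) => /orP [/eqP e|/and3P [-> -> _] //].
  have := mergesU_notin m2; rewrite -e; by rewrite (merges_new m1).
have n1 := mergesU_notin m1; have n3 := mergesU_notin m3.
case: (m1) => B1x B2x B12n _; case: (m2) => C1y C2y _ _; case: (m3) => C1x C2x C12n _.
have aux D : D \in blocks x -> D \in blocks y -> (D != B1) && (D != B2).
  move=> Dx; rewrite (merges_in m1) => /orP [/eqP e|/and3P [-> -> //]].
  by rewrite -e Dx in n1.
have /andP [c1 c2] := aux _ C1x C1y; have /andP [c3 c4] := aux _ C2x C2y.
split=> //.
- by rewrite (merges_in m3) B1x (eq_sym B1 C1) c1 (eq_sym B1 C2) c3 orbT.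
- by rewrite (merges_in m3) B2x (eq_sym B2 C1) c2 (eq_sym B2 C2) c4 orbT.
apply/setP => E; rewrite !inE (merges_in m2) (merges_in m3) (merges_in m1).
have [->|EB] := eqVneq E (B1 :|: B2); first by rewrite /= !(proj1 B12, proj2 B12) orbT.
have [->|EC] /= := eqVneq E (C1 :|: C2).
  rewrite andbT; apply/esym; rewrite negb_or.
  by apply/andP; split; apply: contraNneq n3 => ->.
by rewrite !negb_or; case: (E == B1); case: (E == B2); case: (E == C1); case: (E == C2).
Qed.

Lemma diamond_nested x y y' z A B C :
  merges x y A B -> merges y z (A :|: B) C -> merges x y' C A ->
  merges y' z (C :|: A) B.
Proof.
move=> m1 m2 m3.
have n1 := mergesU_notin m1; have n3 := mergesU_notin m3.
case: (m1) => Ax Bx AB _; case: (m2) => _ Cy CnAB _; case: (m3) => Cx _ CA _.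
have BC : B != C.
  apply: contraTneq Cy => <-; rewrite (merges_in m1) eqxx andbF /= orbF.
  by apply: contraNneq n1 => <-.
split=> //.
- exact: merges_new m3.
- by rewrite (merges_in m3) Bx BC (eq_sym B A) AB orbT.
- by apply: contraNneq n3 => ->.
apply/setP => E; rewrite !inE (merges_in m2) (merges_in m3) (merges_in m1) setUC setUA.
have [//|EU] /= := eqVneq E (C :|: A :|: B); rewrite negb_or.
have [->|E1] := eqVneq E (A :|: B); first by rewrite (negbTE n1) ?andbF ?orbF /=; case: (_ == C :|: A); rewrite ?andbF.
have [->|E2] /= := eqVneq E (C :|: A); first by rewrite (negbTE n3) !andbF.
by case: (E == A); case: (E == B); case: (E == C).
Qed.

Lemma diamond_disjoint_other x y y' z B1 B2 C1 C2 :
  merges x y B1 B2 -> merges y z C1 C2 -> B1 :|: B2 \in blocks z ->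
  step x y' -> (y' <= z)%O -> y' != y -> merges x y' C1 C2.
Proof.
move=> m1 m2 Bz s yz ny; have [E [F m]] := step_merges s.
have B12 : (B1 :|: B2 != C1) /\ (B1 :|: B2 != C2).
  move: Bz; rewrite (merges_in m2) => /orP [/eqP e|/and3P [-> -> _] //].
  by have := mergesU_notin m2; rewrite -e (merges_new m1).
have old D : D \in blocks y -> D != B1 :|: B2 -> D \in blocks x.
  by rewrite (merges_in m1) => /orP [/eqP -> |/and3P []]; rewrite ?eqxx.
case: (m1) => B1x B2x B12n ey; case: (m2) => C1y C2y _ _; case: (m) => Ex Fx EF ey'.
have C1x : C1 \in blocks x by apply: old => //; rewrite eq_sym; case: B12.
have C2x : C2 \in blocks x by apply: old => //; rewrite eq_sym; case: B12.
have [Z Zz] := refinesP _ _ yz _ (merges_new m).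
rewrite subUset => /andP [EZ FZ]; move: Zz; rewrite (merges_in m2) => /orP [/eqP eZ|/and3P [_ _]].
  rewrite eZ in EZ FZ.
  have [e1|e1] := block_subU Ex C1x C2x EZ; have [e2|e2] := block_subU Fx C1x C2x FZ.
  - by rewrite e1 e2 eqxx in EF.
  - by rewrite -e1 -e2.
  - by rewrite -e1 -e2; apply: merges_sym.
  - by rewrite e1 e2 eqxx in EF.
rewrite (merges_in m1) => /orP [/eqP eZ|/and3P [_ _ Zx]]; last first.
  by rewrite (block_sub Ex Zx EZ) (block_sub Fx Zx FZ) eqxx in EF.
rewrite eZ in EZ FZ; case/eqP: ny; apply: val_inj; rewrite /= ey ey'.
have [e1|e1] := block_subU Ex B1x B2x EZ; have [e2|e2] := block_subU Fx B1x B2x FZ.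
- by rewrite e1 e2 eqxx in EF.
- by rewrite e1 e2.
- by rewrite e1 e2 (setUC B2) (setUC [set B2]).
- by rewrite e1 e2 eqxx in EF.
Qed.

Lemma diamond_nested_other x y y' z A B C :
  merges x y A B -> merges y z (A :|: B) C ->
  step x y' -> (y' <= z)%O -> y' != y -> merges x y' C A \/ merges x y' C B.
Proof.
move=> m1 m2 s yz ny; have [E [F m]] := step_merges s.
have old D : D \in blocks y -> D != A :|: B -> D \in blocks x.
  by rewrite (merges_in m1) => /orP [/eqP -> |/and3P []]; rewrite ?eqxx.
case: (m1) => Ax Bx AB ey; case: (m2) => _ Cy CAB _; case: (m) => Ex Fx EF ey'.
have Cx : C \in blocks x by apply: old => //; rewrite eq_sym.
have [Z Zz] := refinesP _ _ yz _ (merges_new m).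
rewrite subUset => /andP [EZ FZ].
have {Zz} eZ : Z = A :|: B :|: C.
  move: Zz; rewrite (merges_in m2) => /orP [/eqP //|/and3P [ZAB _ /old /(_ ZAB) Zx]].
  by rewrite (block_sub Ex Zx EZ) (block_sub Fx Zx FZ) eqxx in EF.
have three D : D \in blocks x -> D \subset Z -> [\/ D = A, D = B | D = C].
  move=> Dx DZ; have [a aD] := block_mem Dx; move/subsetP/(_ a aD): DZ.
  rewrite eZ !inE -orbA => /or3P [] h; [constructor 1|constructor 2|constructor 3];
    by [exact: (block_eq Dx Ax aD h)|exact: (block_eq Dx Bx aD h)|exact: (block_eq Dx Cx aD h)].
have nAB : ~ merges x y' A B.
  by case=> _ _ _ e; case/eqP: ny; apply: val_inj; rewrite /= ey e.
have [e1|e1|e1] := three E Ex EZ; have [e2|e2|e2] := three F Fx FZ; subst E F;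
  rewrite ?eqxx // in EF *; try by [left|right|left; exact: merges_sym|right; exact: merges_sym].
by case: nAB; apply: merges_sym.
Qed.

End SetPartitions.

(** * Block minima and the max-min labels *)

Section Minima.
Context (N : nat).
Implicit Types (x y z : set_partition 'I_N) (B C : {set 'I_N}) (a p : 'I_N).

Definition block_min B a := (a \in B) && [forall b in B, a <= b].

Lemma block_minP B a : reflect (a \in B /\ forall b, b \in B -> a <= b) (block_min B a).
Proof. by apply: (iffP andP) => -[aB /forall_inP h]. Qed.

Lemma block_min_ex B a : a \in B -> exists m, block_min B m.
Proof.
move=> aB; case: (arg_minnP (fun b : 'I_N => val b) aB) => m mB h.
by exists m; apply/block_minP.
Qed.

Lemma block_min_uniq B a b : block_min B a -> block_min B b -> a = b.
Proof.
move=> /block_minP [aB ha] /block_minP [bB hb]; apply: val_inj; apply/eqP.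
by rewrite eqn_leq ha ?hb.
Qed.

Lemma min_labelE B a : block_min B a -> min_label B = a.+1.
Proof.
case/block_minP => aB ha; rewrite /min_label; apply/eqP; rewrite eqn_leq.
apply/andP; split.
  have : a \in index_enum 'I_N by rewrite mem_index_enum.
  elim: (index_enum _) => // b r IH; rewrite inE big_cons => /predU1P [<-|/IH h].
    by rewrite aB geq_minl.
  by case: ifP => // _; apply: leq_trans (geq_minr _ _) h.
elim/big_ind: _ => [|u v|b bB]; last exact: ha.
- exact: ltn_ord.
- by rewrite leq_min => -> ->.
Qed.

Definition mins x : {set 'I_N} := [set a | [exists B in blocks x, block_min B a]].

Lemma minsP x a : reflect (exists2 B, B \in blocks x & block_min B a) (a \in mins x).
Proof. by rewrite inE; apply: (iffP exists_inP). Qed.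

Lemma block_min_inj x B C a : B \in blocks x -> C \in blocks x ->
  block_min B a -> block_min C a -> B = C.
Proof. by move=> Bx Cx /andP [aB _] /andP [aC _]; apply: (block_eq Bx Cx aB aC). Qed.

(** A merge keeps the smaller of the two block minima and loses the larger one,
    which is the label up to the shift between ordinals and labels. *)
Lemma step_label x y : step x y -> exists B C a p,
  [/\ merges x y B C, block_min B a, block_min C p & a < p] /\
  [/\ max_min x y = p.+1, p \in mins x & mins y = mins x :\ p].
Proof.
move=> s; have [B [C m]] := step_merges s.
suff gen B1 C1 a p : merges x y B1 C1 -> block_min B1 a -> block_min C1 p -> a < p ->
    [/\ max_min x y = p.+1, p \in mins x & mins y = mins x :\ p].
  case: (m) => Bx Cx BC _.
  have [a0 a0B] := block_mem Bx; have [c0 c0C] := block_mem Cx.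
  have [a ha] := block_min_ex a0B; have [p hp] := block_min_ex c0C.
  case: (ltngtP a p) => [lt|lt|/val_inj e].
  - by exists B, C, a, p; split; [split|exact: (gen _ _ _ _ m ha hp lt)].
  - by have m' := merges_sym m; exists C, B, p, a; split; [split|exact: (gen _ _ _ _ m' hp ha lt)].
  - by rewrite -e in hp; rewrite (block_min_inj Bx Cx ha hp) eqxx in BC.
move: B1 C1 {B C m} => B C m ha hp ap; case: (m) => Bx Cx BC _; split.
- rewrite /max_min (merges_dead m) big_setU1 ?inE //= big_set1.
  by rewrite (min_labelE ha) (min_labelE hp); apply/maxn_idPr; rewrite ltnS ltnW.
- by apply/minsP; exists C.
apply/setP => b; rewrite !inE; apply/exists_inP/andP.
  case=> D; rewrite (merges_in m) => /orP [/eqP ->|/and3P [DB DC Dx]] hb.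
    have eb : b = a.
      apply: (block_min_uniq hb); apply/block_minP; case/block_minP: ha => aB ha.
      split=> [|c]; rewrite inE ?aB // => /orP [/ha //|cC].
      by case/block_minP: hp => _ /(_ c cC); apply: leq_trans; apply: ltnW.
    rewrite eb; split; first by rewrite -(inj_eq val_inj) neq_ltn ap.
    by apply/exists_inP; exists B.
  split; last by apply/exists_inP; exists D.
  by apply: contraNneq DC => e; rewrite e in hb; rewrite (block_min_inj Dx Cx hb hp).
case=> bp /exists_inP [D Dx hb]; have [eD|DB] := eqVneq D B.
  exists (B :|: C); first exact: merges_new m.
  have eb : b = a by apply: (block_min_uniq hb); rewrite eD.
  rewrite eb; apply/block_minP; case/block_minP: ha => aB ha.
  split=> [|c]; rewrite inE ?aB // => /orP [/ha //|cC].
  by case/block_minP: hp => _ /(_ c cC); apply: leq_trans; apply: ltnW.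
exists D => //; rewrite (merges_in m) DB Dx andbT /=.
by apply/orP; right; apply: contraNneq bp => e; apply/eqP; apply: (block_min_uniq hb); rewrite e.
Qed.

(** Along any maximal chain of [x, z] the labels are the elements by which the
    sets of block minima of x and z differ, in the order in which they are
    lost. *)
Lemma label_swap x y y' z :
  step x y -> step y z -> step x y' -> step y' z ->
  (max_min x y = max_min x y' /\ max_min y z = max_min y' z) \/
  (max_min x y = max_min y' z /\ max_min y z = max_min x y').
Proof.
move=> s1 s2 s3 s4.
have [_ [_ [_ [p1 [_ [-> p1x e1]]]]]] := step_label s1.
have [_ [_ [_ [p2 [_ [-> p2x e2]]]]]] := step_label s2.
have [_ [_ [_ [p3 [_ [-> p3x e3]]]]]] := step_label s3.
have [_ [_ [_ [p4 [_ [-> p4x e4]]]]]] := step_label s4.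
move: p2x p4x; rewrite e1 e3 !in_setD1 => /andP [n2 p2x] /andP [n4 p4x].
have /setP h : mins x :\ p1 :\ p2 = mins x :\ p3 :\ p4 by rewrite -e1 -e3 -e2 -e4.
have := h p1; have := h p2; rewrite !in_setD1 !eqxx p1x p2x !andbT /= !andbF.
move=> /esym /negbT; rewrite negb_and !negbK => /orP [/eqP e24|/eqP e23];
move=> /esym /negbT; rewrite negb_and !negbK => /orP [/eqP e14|/eqP e13].
- by rewrite e24 e14 eqxx in n2.
- by left; rewrite e13 e24.
- by right; rewrite e14 e23.
- by rewrite e13 e23 eqxx in n2.
Qed.

Lemma label_neq x y z : step x y -> step y z -> max_min x y != max_min y z.
Proof.
move=> s1 s2.
have [_ [_ [_ [p1 [_ [-> p1x e1]]]]]] := step_label s1.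
have [_ [_ [_ [p2 [_ [-> p2x e2]]]]]] := step_label s2.
move: p2x; rewrite e1 in_setD1 => /andP [n _].
by rewrite eqSS eq_sym.
Qed.

(** If the smaller lost minimum p goes first, it must be absorbed by a block
    whose minimum is smaller than p, hence survives in z. So that block is the
    one holding the minimum of the z-block of p, and the merge is forced. *)
Lemma ascending_unique x y y' z :
  step x y -> step y z -> step x y' -> step y' z ->
  max_min x y <= max_min y z -> max_min x y' <= max_min y' z -> y = y'.
Proof.
move=> s1 s2 s3 s4 l1 l2.
have e : max_min x y = max_min x y' /\ max_min y z = max_min y' z.
  by case: (label_swap s1 s2 s3 s4) => // -[h1 h2]; lia.
have [B1 [C1 [a1 [p1 [[m1 ha1 hp1 lt1] [f1 p1x e1]]]]]] := step_label s1.
have [_ [_ [_ [q [_ [f2 qy e2]]]]]] := step_label s2.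
have [B3 [C3 [a3 [p3 [[m3 ha3 hp3 lt3] [f3 p3x e3]]]]]] := step_label s3.
have [_ [_ [_ [q4 [_ [f4 _ e4]]]]]] := step_label s4.
case: e; rewrite f1 f3 f2 f4 => -[/val_inj e13] [/val_inj eq4].
rewrite f1 f2 ltnS in l1; subst p3 q4.
case: (m1) => B1x C1x _ ey; case: (m3) => B3x C3x _ ey'.
have eC := block_min_inj C1x C3x hp1 hp3; subst C3.
have small a B : B \in blocks x -> block_min B a -> a < p1 -> a \in mins z.
  move=> Bx ha ap; rewrite e2 e1 !inE -!(inj_eq val_inj) /=.
  rewrite (ltn_eqF ap) (ltn_eqF (leq_trans ap l1)) /=.
  by apply/exists_inP; exists B.
have /minsP [Z Zz hZ] := small _ _ B1x ha1 lt1.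
have /minsP [Z' Zz' hZ'] := small _ _ B3x ha3 lt3.
have pC : p1 \in C1 by case/block_minP: hp1.
have sub w B C a W : step x w -> step w z -> merges x w B C -> p1 \in C -> block_min B a ->
    W \in blocks z -> block_min W a -> p1 \in W.
  move=> s s' m pC' /block_minP [aB _] Wz /block_minP [aW _].
  have wz : (w <= z)%O by case/andP: s'.
  apply: (subsetP (le_block_sub wz (merges_new m) Wz _ aW)); by rewrite inE ?aB ?pC' ?orbT.
have eZ : Z = Z'.
  by apply: (block_eq Zz Zz' (sub _ _ _ _ _ s1 s2 m1 pC ha1 Zz hZ)
                             (sub _ _ _ _ _ s3 s4 m3 pC ha3 Zz' hZ')).
subst Z'; have ea := block_min_uniq hZ hZ'; subst a3.
have eB := block_min_inj B1x B3x ha1 ha3; subst B3.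
by apply: val_inj; rewrite /= ey ey'.
Qed.

End Minima.

(** * Chains in rank two intervals *)

Lemma chainP d (P : finPOrderType d) (c : {set P}) :
  reflect {in c &, forall x y : P, (x >=< y)%O} (is_chain c).
Proof.
apply: (iffP forall_inP) => [h x y xc yc|h x xc]; first exact: (forall_inP (h x xc)).
by apply/forall_inP => y; apply: h.
Qed.

Lemma chainU1 d (P : finPOrderType d) (c : {set P}) w :
  is_chain c -> (forall v, v \in c -> (v >=< w)%O) -> is_chain (w |: c).
Proof.
move=> /chainP hc hw; apply/chainP => u v /setU1P [->|uc] /setU1P [->|vc].
- exact: comparablexx.
- by rewrite comparable_sym; apply: hw.
- exact: hw.
- exact: hc.
Qed.

Section Rank2.
Context (N : nat).
Implicit Types (x y z : set_partition 'I_N).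

Lemma comparable_card x y : (x >=< y)%O -> #|blocks x| = #|blocks y| -> x = y.
Proof.
by case/orP => h e; [apply: le_card_eq|apply/esym/le_card_eq].
Qed.

Lemma comparable_le_card x y : (x >=< y)%O -> #|blocks y| <= #|blocks x| -> (x <= y)%O.
Proof.
move=> /orP [//|yx] c; suff -> : y = x by [].
by apply: le_card_eq => //; apply/eqP; rewrite eqn_leq c le_card.
Qed.

Lemma chain_labels3 dL (L : porderType dL) (lam : set_partition 'I_N -> set_partition 'I_N -> L)
    x y z : (x < y)%O -> (y < z)%O ->
  chain_labels lam [set x; y; z] = [:: lam x y; lam y z].
Proof.
move=> xy yz; have xz := lt_trans xy yz.
rewrite /chain_labels; set s := enum_mem _.
suff -> : sort <=%O s = [:: x; y; z] by [].
have ps : perm_eq s [:: x; y; z].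
  apply: uniq_perm; first exact: fintype.enum_uniq.
    by rewrite /= !inE negb_or (lt_eqF xy) (lt_eqF xz) (lt_eqF yz).
  by move=> w; rewrite fintype.mem_enum !inE orbA.
apply: (sorted_eq le_trans le_anti).
- apply: (@sort_sorted_in _ [in [set x; y; z]]); last by apply/allP => w; rewrite fintype.mem_enum.
  by move=> u v; rewrite !inE -!orbA => /or3P [] /eqP -> /or3P [] /eqP ->;
    rewrite ?lexx ?(ltW xy) ?(ltW yz) ?(ltW xz) ?orbT.
- by rewrite /= (ltW xy) (ltW yz).
- by rewrite perm_sort; exact: ps.
Qed.

Lemma interval2_card x y z w : step x y -> step y z -> w \in interval x z ->
  [\/ w = x, #|blocks w| = #|blocks y| | w = z].
Proof.
move=> /andP [_ /eqP cx] /andP [_ /eqP cy]; rewrite inE => /andP [xw wz].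
have h1 := le_card xw; have h2 := le_card wz.
have [e|n1] := eqVneq #|blocks x| #|blocks w|.
  by constructor 1; apply/esym/le_card_eq.
have [e|n2] := eqVneq #|blocks w| #|blocks z|.
  by constructor 3; apply/le_card_eq.
constructor 2; lia.
Qed.

Lemma interval2_max_chain x y z : step x y -> step y z ->
  max_chain_of_interval x z [set x; y; z].
Proof.
move=> s1 s2; have xy := step_lt s1; have yz := step_lt s2; have xz := lt_trans xy yz.
apply/maxsetP; split.
  apply/andP; split.
    apply/chainP => u v; rewrite !inE -!orbA => /or3P [] /eqP -> /or3P [] /eqP ->;
    by rewrite /Order.comparable ?lexx ?(ltW xy) ?(ltW yz) ?(ltW xz) ?orbT.
  by apply/subsetP => u; rewrite !inE -!orbA => /or3P [] /eqP ->;
    rewrite ?lexx ?(ltW xy) ?(ltW yz) ?(ltW xz).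
move=> c /andP [/chainP cc /subsetP cI] sc; apply/eqP; rewrite eqEsubset sc andbT.
apply/subsetP => w wc; rewrite !inE.
have yc : y \in c by apply: (subsetP sc); rewrite !inE eqxx orbT.
case: (interval2_card s1 s2 (cI w wc)) => [->|e|->]; rewrite ?eqxx ?orbT //.
by rewrite (comparable_card (cc _ _ wc yc) e) eqxx orbT.
Qed.

(** Adding x, z and the given middle element whenever they are comparable to
    everything shows that no maximal chain of the interval can be shorter. *)
Lemma max_chain_of_interval2 x y z c : step x y -> step y z ->
  max_chain_of_interval x z c ->
  exists y', [/\ step x y', step y' z & c = [set x; y'; z]].
Proof.
move=> s1 s2 /maxsetP [/andP [cc cI] mx].
have add w : w \in interval x z -> (forall v, v \in c -> (v >=< w)%O) -> w \in c.
  move=> wI cw; rewrite -(mx (w |: c)) ?setU11 ?subsetUr //.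
  by rewrite chainU1 //= subUset sub1set wI.
have xz : (x <= z)%O := ltW (lt_trans (step_lt s1) (step_lt s2)).
have xc : x \in c.
  apply: add; first by rewrite inE lexx.
  by move=> v /(subsetP cI); rewrite inE => /andP [xv _]; apply/orP; right.
have zc : z \in c.
  apply: add; first by rewrite inE lexx xz.
  by move=> v /(subsetP cI); rewrite inE => /andP [_ vz]; apply/orP; left.
have [y' y'c e'] : exists2 y', y' \in c & #|blocks y'| = #|blocks y|.
  have [/exists_inP [w wc /eqP e]|no] := boolP [exists w in c, #|blocks w| == #|blocks y|].
    by exists w.
  exists y => //; apply: add => [|v vc].
    by rewrite inE (ltW (step_lt s1)) (ltW (step_lt s2)).
  case: (interval2_card s1 s2 (subsetP cI v vc)) => [->|e|->].
  - by rewrite /Order.comparable (ltW (step_lt s1)).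
  - by case/negP: no; apply/exists_inP; exists v; rewrite ?e.
  - by rewrite /Order.comparable (ltW (step_lt s2)) orbT.
exists y'; have := subsetP cI y' y'c; rewrite inE => /andP [xy' y'z].
case/andP: (s1) => _ cx; case/andP: (s2) => _ cz.
split; rewrite /step ?xy' ?y'z ?e' //.
apply/eqP; rewrite eqEsubset; apply/andP; split; apply/subsetP => v; last first.
  by rewrite !inE -orbA => /or3P [] /eqP ->.
move=> vc; rewrite !inE; case: (interval2_card s1 s2 (subsetP cI v vc)) => [->|e|->];
  rewrite ?eqxx ?orbT //.
move/chainP: cc => cc.
by rewrite (comparable_card (cc _ _ vc y'c)) ?eqxx ?orbT // e.
Qed.

Lemma ascending2 x y z : step x y -> step y z ->
  ascending (@max_min N) [set x; y; z] = (max_min x y <= max_min y z).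
Proof.
by move=> s1 s2; rewrite /ascending (chain_labels3 _ (step_lt s1) (step_lt s2)) /= andbT.
Qed.

Lemma unique_ascending2 x y z : step x y -> step y z ->
  max_min x y <= max_min y z -> unique_ascending (@max_min N) x z [set x; y; z].
Proof.
move=> s1 s2 l; apply/and3P; split.
- exact: interval2_max_chain.
- by rewrite ascending2.
apply/forallP => c; apply/implyP => /andP [mc].
have [y' [s3 s4 ->]] := max_chain_of_interval2 s1 s2 mc.
by rewrite ascending2 // => l'; rewrite (ascending_unique s1 s2 s3 s4 l l').
Qed.

End Rank2.

(** * Maximal chains as sequences, and polygon moves *)

Section Stages.
Context (n : nat).
Local Notation SP := (set_partition 'I_n.+1).
Implicit Types (x y z : SP) (m : max_chain SP).

Lemma card_bot : #|blocks (\bot%O : SP)| = n.+1.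
Proof.
rewrite -[RHS]card_ord -cardsT; apply: card_imset => a b /setP /(_ b).
by rewrite !inE eqxx => /eqP.
Qed.

Lemma card_top : #|blocks (\top%O : SP)| = 1.
Proof.
apply/eqP/cards1P; exists setT; apply/setP => B; rewrite inE.
apply/imsetP/eqP => [[a _ ->]|->]; first by apply/setP => b; rewrite !inE.
by exists ord0 => //; apply/setP => b; rewrite !inE.
Qed.

Lemma card_ub x : #|blocks x| <= n.+1.
Proof. by have := le_card (le0x x); rewrite card_bot. Qed.

Lemma card_lb x : 0 < #|blocks x|.
Proof. exact: card_blocks_gt0 ord0. Qed.

Lemma max_chain_comp m : {in m &, forall x y, (x >=< y)%O}.
Proof. by apply/chainP; case/maxsetP: (valP m). Qed.

Lemma max_chain_add m y : (forall x, x \in m -> (x >=< y)%O) -> y \in m.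
Proof.
move=> h; case/maxsetP: (valP m) => cc mx.
suff <- : y |: m = m by apply: setU11.
by apply: mx; [apply: chainU1|apply: subsetUr].
Qed.

(** The element of rank j of the chain; a maximal chain has exactly one for
    every j <= n, so the default value only matters outside that range. *)
Definition stage m j : SP := odflt \bot%O [pick x in m | #|blocks x| == n.+1 - j].

(** Maximality leaves no gaps: merging two blocks of the element of rank j
    inside the next element of the chain gives something comparable to the
    whole chain. *)
Lemma stage_ex m j : j <= n -> exists2 x, x \in m & #|blocks x| = n.+1 - j.
Proof.
elim: j => [|j IH] jn.
  exists \bot%O; last by rewrite card_bot.
  by apply: max_chain_add => x _; apply/orP; right; apply: le0x.
have [x xm cx] := IH (ltnW jn).
have tm : (\top%O \in m) && (x < \top)%O.
  apply/andP; split; first by apply: max_chain_add => y _; apply/orP; left; apply: lex1.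
  rewrite lt_neqAle lex1 andbT; apply/eqP => e.
  by move: cx; rewrite e card_top; lia.
(* Among the elements above x, the one with most blocks is the next one. *)
case: (arg_maxnP (P := fun z => (z \in m) && (x < z)%O) (fun z => #|blocks z|) tm).
move=> z /andP [zm xz] hz; have [B [C [u [mu uz]]]] := lt_merges xz.
exists u; last by have := merges_card mu; lia.
apply: max_chain_add => w wm.
case/orP: (max_chain_comp wm xm) => [wx|].
  by apply/orP; left; apply: le_trans wx (merges_le mu).
rewrite le_eqVlt => /orP [/eqP <-|xw].
  by apply/orP; left; apply: merges_le mu.
apply/orP; right; apply: le_trans uz _.
by apply: comparable_le_card (max_chain_comp zm wm) _; apply: hz; rewrite wm.
Qed.

Lemma stage_in m j : j <= n -> stage m j \in m.
Proof.
move=> /(stage_ex m) [x xm cx]; rewrite /stage; case: pickP => [y /andP [] //|].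
by move/(_ x); rewrite xm cx eqxx.
Qed.

Lemma stage_card m j : j <= n -> #|blocks (stage m j)| = n.+1 - j.
Proof.
move=> /(stage_ex m) [x xm cx]; rewrite /stage; case: pickP => [y /andP [_ /eqP] //|].
by move/(_ x); rewrite xm cx eqxx.
Qed.

Lemma stage_eq m j x : j <= n -> x \in m -> #|blocks x| = n.+1 - j -> stage m j = x.
Proof.
move=> jn xm cx; apply: comparable_card; last by rewrite cx stage_card.
exact: (max_chain_comp (stage_in m jn) xm).
Qed.

Lemma stage_onto m x : x \in m -> stage m (n.+1 - #|blocks x|) = x.
Proof.
move=> xm; have := card_ub x; have := card_lb x => h1 h2.
by apply: stage_eq; rewrite ?subKn //; lia.
Qed.

Lemma stage_le m j k : j <= k -> k <= n -> (stage m j <= stage m k)%O.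
Proof.
move=> jk kn; have jn := leq_trans jk kn.
apply: comparable_le_card; last by rewrite !stage_card // leq_sub2l.
exact: (max_chain_comp (stage_in m jn) (stage_in m kn)).
Qed.

Lemma stage_step m j : j < n -> step (stage m j) (stage m j.+1).
Proof.
move=> jn; rewrite /step stage_le // !stage_card ?(ltnW jn) //; apply/eqP; lia.
Qed.

Lemma stage0 m : stage m 0 = \bot%O.
Proof. by apply/esym/le_card_eq; rewrite ?le0x // stage_card // card_bot. Qed.

Lemma stage_inj m m' : (forall j, j <= n -> stage m j = stage m' j) -> m = m'.
Proof.
move=> h; apply: val_inj; apply/setP => x /=; apply/idP/idP => xm.
  by rewrite -(stage_onto xm) h ?stage_in //; have := card_lb x; lia.
by rewrite -(stage_onto xm) -h ?stage_in //; have := card_lb x; lia.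
Qed.

Definition seq_chain (X : nat -> SP) : {set SP} :=
  [set x | [exists i : 'I_n.+1, x == X i]].

Lemma seq_chainP X x : reflect (exists2 j, j <= n & x = X j) (x \in seq_chain X).
Proof.
rewrite inE; apply: (iffP existsP) => [[i /eqP ->]|[j jn ->]].
  by exists i; rewrite // -ltnS.
by exists (Ordinal (jn : j < n.+1)).
Qed.

Section SeqChain.
Context (X : nat -> SP).
Hypotheses (X0 : X 0 = \bot%O) (XS : forall j, j < n -> step (X j) (X j.+1)).

Lemma seq_card j : j <= n -> #|blocks (X j)| = n.+1 - j.
Proof.
elim: j => [|j IH] jn; first by rewrite X0 card_bot.
by have /andP [_ /eqP c] := XS jn; move: c; rewrite (IH (ltnW jn)) subSS (subSn (ltnW jn)) => -[].
Qed.

Lemma seq_le j k : j <= k -> k <= n -> (X j <= X k)%O.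
Proof.
move=> /subnK <-; elim: (k - j) => // d IH dn.
apply: le_trans (IH _) _; first by lia.
by rewrite addSn; have /andP [] := XS dn.
Qed.

Lemma seq_chain_max : maxset (@is_chain _ SP) (seq_chain X).
Proof.
apply/maxsetP; split=> [|c /chainP cc sc].
  apply/chainP => x y /seq_chainP [j jn ->] /seq_chainP [k kn ->].
  apply/orP; case: (leqP j k) => [jk|/ltnW kj]; [left|right]; exact: seq_le.
apply/eqP; rewrite eqEsubset sc andbT; apply/subsetP => x xc.
have h1 := card_ub x; have h2 := card_lb x.
have jn : n.+1 - #|blocks x| <= n by lia.
apply/seq_chainP; exists (n.+1 - #|blocks x|) => //.
apply: comparable_card; last by rewrite seq_card // subKn.
by apply: cc => //; apply: (subsetP sc); apply/seq_chainP; exists (n.+1 - #|blocks x|).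
Qed.

Lemma stage_seq m j : chain_set m = seq_chain X -> j <= n -> stage m j = X j.
Proof.
move=> e jn; apply: stage_eq; rewrite ?seq_card // e.
by apply/seq_chainP; exists j.
Qed.

End SeqChain.

(** What is left of a polygon move once the interval, its ascending chain and
    the descent have been described by ranks and labels. *)
Definition chain_move m m' i :=
  [/\ 0 < i < n, forall j, j <= n -> j != i -> stage m j = stage m' j,
      stage m i != stage m' i &
      max_min (stage m i.-1) (stage m i) < max_min (stage m i) (stage m i.+1)].

Lemma chain_interval m i : 0 < i < n ->
  m :&: interval (stage m i.-1) (stage m i.+1) =
  [set stage m i.-1; stage m i; stage m i.+1].
Proof.
case/andP => i0 iN; have s1 : step (stage m i.-1) (stage m i).
  by have := @stage_step m i.-1; rewrite prednK //; apply; apply: ltnW.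
have s2 := stage_step m iN.
apply/setP => w; rewrite in_setI in_setU in_set2 in_set1 -orbA; apply/andP/or3P.
  case=> wm wI; case: (interval2_card s1 s2 wI) => [->|e|->].
  - by constructor 1.
  - by constructor 2; rewrite (comparable_card (max_chain_comp wm (stage_in m (ltnW iN))) e).
  - by constructor 3.
case=> /eqP ->; rewrite stage_in ?inE ?stage_le //; lia.
Qed.

Lemma chain_below_stage m m' i : i <= n ->
  (forall j, j <= i -> stage m j = stage m' j) ->
  chain_below m (stage m i) \subset chain_below m' (stage m' i).
Proof.
move=> iN h; apply/subsetP => w; rewrite !inE => /andP [wm wi].
have := le_card wi; rewrite stage_card // => c.
by rewrite -(h i) // wi andbT -(stage_onto wm) h ?stage_in //; lia.
Qed.

Lemma chain_above_stage m m' i : i <= n ->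
  (forall j, i <= j <= n -> stage m j = stage m' j) ->
  chain_above m (stage m i) \subset chain_above m' (stage m' i).
Proof.
move=> iN h; apply/subsetP => w; rewrite !inE => /andP [wm wi].
have := le_card wi; rewrite stage_card // => c; have := card_lb w => c'.
by rewrite -(h i) ?leqnn // wi andbT -(stage_onto wm) h ?stage_in //; lia.
Qed.

Lemma stage_arith k a b c : a = b.+1 -> b = c.+1 -> a <= k.+1 -> 0 < c ->
  let i := k.+1 - b in
  [/\ 0 < i, i < k, k.+1 - i.-1 = a, k.+1 - i = b & k.+1 - i.+1 = c].
Proof. by move=> -> -> h1 h2; split; lia. Qed.

(** The descent condition on m' and the uniqueness of the ascending chain are
    both consequences of the strict increase of the labels of m, through
    [ascending_unique]. *)
Lemma polygon_moveP m m' :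
  reflect (exists i, chain_move m m' i) (polygon_move (@max_min n.+1) m m').
Proof.
apply: (iffP existsP) => [[x /existsP [z]]|[i [/andP [i0 iN] ag ne lt]]].
  case/and5P => xz; rewrite !in_setI => /andP [xm xm'] /andP [zm zm'] /eqP cb.
  case/and3P => /eqP ca /existsP [y /and3P [/eqP eI /and3P [c1 c2 nl] ym]].
  case/and3P => _ asc _.
  rewrite !covers_step in c1 c2.
  have ym' : y \in m'.
    have : y \in [set x; y; z] by rewrite !inE eqxx orbT.
    by rewrite -eI inE => /andP [].
  case/andP: (c1) => xy /eqP k1; case/andP: (c2) => yz /eqP k2.
  have h1 := card_ub x; have h2 := card_lb z.
  pose i := n.+1 - #|blocks y|; exists i.
  have [i0 iN ax ay az] := stage_arith k1 k2 h1 h2.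
  rewrite -/i in i0 iN ax ay az; clearbody i.
  have i1 : i.-1 <= n by apply: leq_trans (leq_pred i) (ltnW iN).
  have ex : stage m i.-1 = x by apply: stage_eq.
  have ez : stage m i.+1 = z by apply: stage_eq.
  have ex' : stage m' i.-1 = x by apply: stage_eq.
  have ez' : stage m' i.+1 = z by apply: stage_eq.
  have ey : stage m' i = y by apply: stage_eq; rewrite // ltnW.
  have s1 : step (stage m i.-1) (stage m i).
    by have := @stage_step m i.-1; rewrite prednK //; apply; apply: ltnW.
  have s2 := stage_step m iN.
  split; rewrite ?i0 ?iN //.
  - move=> j jn ji; apply/esym/stage_eq => //; last exact: stage_card.
    have sm := stage_in m jn; case: (ltngtP j i) => ji'; last by rewrite ji' eqxx in ji.
      have : stage m j \in chain_below m x.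
        by rewrite inE sm -ex stage_le //; case: (i) i0 ji'.
      by rewrite cb inE => /andP [].
    have : stage m j \in chain_above m z by rewrite inE sm -ez stage_le.
    by rewrite ca inE => /andP [].
  - by apply: contraNneq ym => e; rewrite -ey -e stage_in // ltnW.
  - rewrite ltn_neqAle label_neq // -ascending2 //.
    by rewrite -(@chain_interval m i) ?i0 // ex ez.
have i1 : i.-1 <= n by apply: leq_trans (leq_pred i) (ltnW iN).
have ii1 : i.-1 != i by case: (i) i0 => // k _; rewrite neq_ltn leqnn.
have ii2 : i.+1 != i by rewrite neq_ltn leqnn orbT.
have s1 : step (stage m i.-1) (stage m i).
  by have := @stage_step m i.-1; rewrite prednK //; apply; apply: ltnW.
have s2 := stage_step m iN.
have s3 : step (stage m' i.-1) (stage m' i).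
  by have := @stage_step m' i.-1; rewrite prednK //; apply; apply: ltnW.
have s4 := stage_step m' iN.
have agx : stage m i.-1 = stage m' i.-1 by apply: ag.
have agz : stage m i.+1 = stage m' i.+1 by apply: ag.
exists (stage m i.-1); apply/existsP; exists (stage m i.+1).
apply/and5P; split.
- exact: lt_trans (step_lt s1) (step_lt s2).
- by rewrite inE stage_in // agx stage_in.
- by rewrite inE stage_in // agz stage_in.
- rewrite eqEsubset {2 3}agx; apply/andP; split; apply: chain_below_stage => // j ji;
    [|apply: esym]; apply: ag; clear -ji i0 iN; lia.
apply/and3P; split.
- rewrite eqEsubset {2 3}agz; apply/andP; split; apply: chain_above_stage => // j ji;
    [|apply: esym]; apply: ag; clear -ji i0 iN; lia.
- apply/existsP; exists (stage m' i); rewrite agx agz chain_interval ?i0 // eqxx /=.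
  apply/andP; split; last first.
    apply: contra ne => h; apply/eqP; apply: stage_eq => //; first exact: ltnW.
    by rewrite stage_card // ltnW.
  apply/and3P; rewrite !covers_step; split=> //.
  apply: contra ne => l; apply/eqP; rewrite -agx in s3 l; rewrite -agz in s4 l.
  exact: (ascending_unique s1 s2 s3 s4 (ltnW lt) l).
- by rewrite chain_interval ?i0 //; apply: unique_ascending2 => //; apply: ltnW.
Qed.

End Stages.

(** * The partition sequence of a tree *)

Lemma connect_ind (V : finType) (e : rel V) (Q : V -> Prop) u v :
  (forall a b, Q a -> e a b -> Q b) -> Q u -> connect e u v -> Q v.
Proof.
move=> h Qu /connectP [s es ->]; elim: s u es Qu => //= a s IH u /andP [ua as_] Qu.
by apply: IH => //; apply: h Qu ua.
Qed.

Lemma imset_setD (aT rT : finType) (f : aT -> rT) (A B : {set aT}) :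
  injective f -> f @: (A :\: B) = (f @: A) :\: (f @: B).
Proof.
move=> inj; apply/setP => y; rewrite inE; apply/imsetP/andP => [[x]|[]].
  by rewrite inE => /andP [xB xA] ->; rewrite !mem_imset.
by move=> yB /imsetP [x xA e]; exists x => //; rewrite inE xA andbT -(mem_imset B x inj) -e.
Qed.

Section Tree.
Context (n : nat) (T : PT n).
Local Notation V := 'I_(n.*2.+1).
Local Notation SP := (set_partition 'I_n.+1).
Implicit Types (u v w r c : V) (j : 'I_n.+1) (k : nat).

Lemma treeP : [&& rooted_tree T, full_binary T, decreasing T &
          [forall v, is_leaf T v == (label v <= n.+1)]].
Proof. exact: (valP T). Qed.

Lemma leafE v : is_leaf T v = (v <= n).
Proof. by case/and4P: treeP => _ _ _ /forallP /(_ v) /eqP ->. Qed.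

Lemma anc_le u v : in_subtree T u v -> v <= u.
Proof.
have [-> //|vu] := eqVneq v u; case/and4P: treeP => _ _ /forallP /(_ u) /forallP /(_ v) h _ uv.
by move: h; rewrite uv vu /label ltnS => /ltnW.
Qed.

(** The decreasing condition only compares distinct vertices, so loops have to
    be excluded by following the path from the root, which never enters one. *)
Lemma parent_neq v : T v != Some v.
Proof.
apply/eqP => pv; case/and4P: treeP => /existsP [r /andP [/eqP pr /forallP /(_ v) rv]] _ _ _.
suff : v <> v by [].
apply: (connect_ind (Q := fun w => w <> v) _ _ rv) => [a b av /eqP pb bv|rv'].
  by apply: av; rewrite bv pv in pb; case: pb.
by rewrite -rv' pr in pv.
Qed.

Lemma anc_child u c : T c = Some u -> in_subtree T u c.
Proof. by move=> pc; apply: connect1; rewrite pc. Qed.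

Lemma parent_gt v u : T v = Some u -> v < u.
Proof.
move=> pv; rewrite ltn_neqAle (anc_le (anc_child pv)) andbT.
by apply: contra_eq_neq pv => /val_inj ->; apply: parent_neq.
Qed.

Lemma anc_refl u : in_subtree T u u. Proof. exact: connect0. Qed.

Lemma anc_trans u v w : in_subtree T u v -> in_subtree T v w -> in_subtree T u w.
Proof. exact: connect_trans. Qed.

Lemma anc_bottom u v w : in_subtree T u v -> T v = Some w -> u = v \/ in_subtree T u w.
Proof.
case/connectP => s; elim/last_ind: s => [|s b _] /=; first by move=> _ ->; left.
rewrite rcons_path last_rcons => /andP [us /eqP pb] -> pv; right.
by move: pb; rewrite pv => -[->]; apply/connectP; exists s.
Qed.

Lemma anc_top u v : in_subtree T u v -> u = v \/ exists2 c, T c = Some u & in_subtree T c v.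
Proof.
case/connectP => -[|c s] /=; first by left.
case/andP => /eqP pc cs ->; right; exists c => //.
by apply/connectP; exists s.
Qed.

Lemma anc_total u v w : in_subtree T u w -> in_subtree T v w ->
  in_subtree T u v \/ in_subtree T v u.
Proof.
move=> uw vw; pose Q w := in_subtree T v w /\
  (in_subtree T u w -> in_subtree T u v \/ in_subtree T v u).
suff [_ /(_ uw)] : Q w by [].
apply: (connect_ind _ _ vw) => [a b [va h] /eqP pb|]; last by split; [exact: anc_refl|left].
have vb := anc_trans va (anc_child pb); split=> // ub.
by have [->|] := anc_bottom ub pb; [right|exact: h].
Qed.

Lemma anc_sibling c c' u : T c = Some u -> T c' = Some u -> c != c' -> ~ in_subtree T c c'.
Proof.
move=> pc pc' ne cc'; have [e|/anc_le] := anc_bottom cc' pc'; first by rewrite e eqxx in ne.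
by rewrite leqNgt (parent_gt pc).
Qed.

Definition leaf_set u : {set 'I_n.+1} := [set j | in_subtree T u (leaf_vertex j)].

Lemma childrenE u c : (c \in children T u) = (T c == Some u).
Proof. by rewrite inE. Qed.

Lemma children_internal u : n < u ->
  exists c1 c2, c1 != c2 /\ children T u = [set c1; c2].
Proof.
move=> nu; case/and4P: treeP => _ /forallP /(_ u) /implyP h _ _.
have : #|children T u| == 2 by apply: h; rewrite leafE -ltnNge.
by move=> /cards2P [c1 [c2 [ne ->]]]; exists c1, c2.
Qed.

Lemma parent_internal v u : T v = Some u -> n < u.
Proof.
move=> pv; rewrite ltnNge -leafE; apply/negP => /eqP e.
by have := childrenE u v; rewrite e inE pv eqxx.
Qed.

Lemma anc_leaf u v : u <= n -> in_subtree T u v -> u = v.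
Proof.
move=> un /anc_top [//|[c /parent_internal]]; by rewrite ltnNge un.
Qed.

Lemma leaf_vertex_le j : (leaf_vertex j : V) <= n.
Proof. by rewrite /= -ltnS. Qed.

Lemma leaf_set_leaf j : leaf_set (leaf_vertex j) = [set j].
Proof.
apply/setP => i; rewrite !inE; apply/idP/eqP => [h|->]; last exact: anc_refl.
by apply: val_inj; have /(congr1 val) := anc_leaf (leaf_vertex_le j) h.
Qed.

Lemma leafP u : u <= n -> exists j, u = leaf_vertex j.
Proof. by rewrite -ltnS => un; exists (Ordinal un); apply: val_inj. Qed.

Lemma leaf_set_sub u v : in_subtree T u v -> leaf_set v \subset leaf_set u.
Proof. by move=> uv; apply/subsetP => j; rewrite !inE; apply: anc_trans. Qed.

Lemma leaf_set_internal u c1 c2 : n < u -> children T u = [set c1; c2] ->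
  leaf_set u = leaf_set c1 :|: leaf_set c2.
Proof.
move=> nu ec; have pc c : (T c == Some u) = (c \in [set c1; c2]) by rewrite -ec childrenE.
apply/eqP; rewrite eqEsubset subUset !leaf_set_sub ?andbT; first last.
- by apply/anc_child/eqP; rewrite pc !inE eqxx.
- by apply/anc_child/eqP; rewrite pc !inE eqxx orbT.
apply/subsetP => j; rewrite !inE => /anc_top [e|[c /eqP]].
  by have := leaf_vertex_le j; rewrite -e leqNgt nu.
by rewrite pc !inE => /orP [] /eqP -> ->; rewrite ?orbT.
Qed.

Lemma leaf_set_mem u : exists j, j \in leaf_set u.
Proof.
elim/ltn_ind: {u}(u : nat) {-2}u (erefl (u : nat)) => m IH u eu.
have [/leafP [j ->]|nu] := leqP u n; first by exists j; rewrite leaf_set_leaf inE.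
have [c1 [c2 [_ ec]]] := children_internal nu.
have pc : T c1 = Some u by apply/eqP; rewrite -childrenE ec !inE eqxx.
have [j jc] := IH c1 (eq_ind _ (fun m => c1 < m) (parent_gt pc) _ eu) c1 erefl.
by exists j; rewrite (leaf_set_internal nu ec) inE jc.
Qed.

Lemma leaf_set_meet u v j : j \in leaf_set u -> j \in leaf_set v -> in_subtree T u v \/ in_subtree T v u.
Proof. by rewrite !inE; apply: anc_total. Qed.

(** Two vertices with a common leaf are comparable; if they are distinct, the
    lower one misses the leaves below one of the two children of the other. *)
Lemma leaf_set_inj : injective leaf_set.
Proof.
suff h u v : in_subtree T u v -> leaf_set u = leaf_set v -> u = v.
  move=> u v e; have [j ju] := leaf_set_mem u.
  have := ju; rewrite e => jv; case: (leaf_set_meet ju jv) => /h; first exact.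
  by move=> h'; apply/esym/h'.
move=> /anc_top [//|[c pc cv]] e.
have [c1 [c2 [ne ec]]] := children_internal (parent_internal pc).
have [d [pd dc]] : exists d, T d = Some u /\ d != c.
  have := pc; move/eqP; rewrite -childrenE ec !inE => /orP [] /eqP ->; [exists c2|exists c1].
    by split; [apply/eqP; rewrite -childrenE ec !inE eqxx orbT|rewrite eq_sym].
  by split; [apply/eqP; rewrite -childrenE ec !inE eqxx|].
have [j jd] := leaf_set_mem d.
have jc : j \in leaf_set c.
  by apply: (subsetP (leaf_set_sub cv)); rewrite -e; apply: (subsetP (leaf_set_sub (anc_child pd))).
case: (leaf_set_meet jc jd) => [/(anc_sibling pc pd)|/(anc_sibling pd pc)]; last exact.
by rewrite eq_sym => /(_ dc).
Qed.

(** The largest vertices of the components of the tree restricted to the labels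
    at most n + 1 + k, that is, to the ordinals at most n + k. *)
Definition roots k : {set V} :=
  [set v : V | (v <= n + k) && (if T v is Some w then n + k < w else true)].

Lemma root_ex k v : v <= n + k -> exists2 r, r \in roots k & in_subtree T r v.
Proof.
move=> vk; have h : (v <= n + k) && in_subtree T v v by rewrite vk anc_refl.
case: (arg_maxnP (P := fun r : V => (r <= n + k) && in_subtree T r v) (fun r => val r) h).
move=> r /andP [rk rv] mr; exists r => //; rewrite inE rk /=.
case pr : (T r) => [w|//]; rewrite ltnNge; apply/negP => wk.
have := mr w; rewrite wk (anc_trans (anc_child pr) rv) => /(_ isT).
by rewrite /= leqNgt (parent_gt pr).
Qed.

Lemma root_anc k r v : r \in roots k -> v <= n + k -> in_subtree T v r -> v = r.
Proof.
rewrite inE => /andP [rk]; case pr : (T r) => [w|] h vk vr.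
  have [//|/anc_le wv] := anc_bottom vr pr.
  by move: h; rewrite ltnNge (leq_trans wv vk).
have [//|[c pc cr]] := anc_top vr.
move: vr => /connectP [s]; elim/last_ind: s => [|s b _] /=; first by move=> _ ->.
by rewrite rcons_path last_rcons => /andP [_ /eqP pb] e; rewrite e pb in pr.
Qed.

(** A path in the restricted forest cannot climb past the root r of its
    component, since the parent of r has too large a label. *)
Lemma component_leavesE k r v : r \in roots k -> in_subtree T r v ->
  component_leaves T (n + 1 + k) v = leaf_set r.
Proof.
move=> rr rv; have rk : r <= n + k by move: rr; rewrite inE => /andP [].
(* Both orientations are carried along, as [connect] is oriented. *)
pose Q w := [/\ in_subtree T r w, connect (restricted_edge T (n + 1 + k)) w r &
                connect (restricted_edge T (n + 1 + k)) r w].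
have Qw w : in_subtree T r w -> Q w.
  apply: connect_ind => [a b [ra ar ra'] /eqP pb|]; last first.
    by split; [exact: anc_refl|exact: connect0|exact: connect0].
  have rb := anc_trans ra (anc_child pb).
  have lab : (label a <= n + 1 + k) && (label b <= n + 1 + k).
    rewrite /label addn1 addSn !ltnS.
    by rewrite (leq_trans (anc_le ra) rk) (leq_trans (anc_le rb) rk).
  case/andP: lab => la lb; split=> //.
    by apply: connect_trans ar; apply: connect1; rewrite /restricted_edge la lb pb eqxx.
  by apply: connect_trans ra' _; apply: connect1; rewrite /restricted_edge la lb pb eqxx orbT.
apply/setP => j; rewrite !inE; apply/idP/idP => [|/Qw [_ _ h]]; last first.
  by case: (Qw v rv) => _ vr _; apply: connect_trans vr h.
apply: (connect_ind (Q := fun w => in_subtree T r w)) => // a b ra /and3P [la lb].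
case/orP => /eqP pa; last exact: (anc_trans ra (anc_child pa)).
have [e|//] := anc_bottom ra pa; move: rr; rewrite inE e pa => /andP [_].
by move: lb; rewrite /label addn1 addSn ltnS leqNgt => /negP.
Qed.

Lemma chain_blocksE k : chain_blocks T k = leaf_set @: roots k.
Proof.
apply/setP => B; apply/imsetP/imsetP => [[v]|[r rr ->]].
  rewrite inE /label addn1 addSn ltnS => vk ->; have [r rr rv] := root_ex vk.
  by exists r => //; rewrite -(component_leavesE rr rv) addn1.
exists r; first by move: rr; rewrite !inE /label addn1 addSn ltnS => /andP [].
by rewrite (component_leavesE rr (anc_refl r)).
Qed.

Lemma tree_partition k : partition (chain_blocks T k) setT.
Proof.
rewrite chain_blocksE; apply/and3P; split.
- apply/eqP/setP => j; rewrite inE; apply/bigcupP.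
  have [r rr rj] : exists2 r, r \in roots k & in_subtree T r (leaf_vertex j).
    by apply: root_ex; apply: leq_trans (leaf_vertex_le j) (leq_addr _ _).
  by exists (leaf_set r); [apply: imset_f|rewrite inE].
- apply/trivIsetP => _ _ /imsetP [r rr ->] /imsetP [r' rr' ->] ne.
  rewrite -setI_eq0; apply/eqP/setP => j; rewrite [RHS]inE; apply/negP.
  have rk : r <= n + k by move: rr; rewrite inE => /andP [].
  have rk' : r' <= n + k by move: rr'; rewrite inE => /andP [].
  case/setIP => jr jr'; case/eqP: ne; congr leaf_set.
  by have [/(root_anc rr' rk)|/(root_anc rr rk')] := leaf_set_meet jr jr'.
- apply/negP => /imsetP [r _ /setP e]; have [j] := leaf_set_mem r.
  by rewrite -e inE.
Qed.

Definition tree_stage k : SP := SetPartition (tree_partition k).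

Lemma tree_stageE k : blocks (tree_stage k) = leaf_set @: roots k.
Proof. exact: chain_blocksE. Qed.

(** An internal vertex u is the ordinal n + k for k = u - n: it is created at
    stage k, and the same stage hides its two children. *)
Lemma roots_born u : n < u -> roots (u - n) :\: roots (u - n).-1 = [set u].
Proof.
move=> nu; have e1 : n + (u - n) = u by rewrite subnKC // ltnW.
have e2 : n + (u - n).-1 = u.-1 by rewrite -subn1 addnBA ?e1 ?subn1 // subn_gt0.
have lt w : (u.-1 < w) = (u <= w) by rewrite prednK //; apply: leq_ltn_trans nu.
apply/setP => v; rewrite in_setD in_set1 /roots !in_set e1 e2; apply/andP/eqP => [|->].
  case; case: (T v) => [w|]; rewrite ?andbT ?lt.
    rewrite negb_and -ltnNge -ltnNge lt => /orP [uv /andP [vu _]|wu /andP [_ uw]].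
      by apply: val_inj; apply/eqP; rewrite eqn_leq vu.
    by move: wu; rewrite ltnNge (ltnW uw).
  by rewrite -ltnNge lt => uv vu; apply: val_inj; apply/eqP; rewrite eqn_leq vu.
rewrite leqnn leqNgt lt leqnn; split=> //.
by case pu : (T u) => [w|//]; rewrite (parent_gt pu).
Qed.

Lemma roots_dead u : n < u -> roots (u - n).-1 :\: roots (u - n) = children T u.
Proof.
move=> nu; have e1 : n + (u - n) = u by rewrite subnKC // ltnW.
have e2 : n + (u - n).-1 = u.-1 by rewrite -subn1 addnBA ?e1 ?subn1 // subn_gt0.
have u0 : 0 < u by apply: leq_ltn_trans nu.
have lt w : (u.-1 < w) = (u <= w) by rewrite prednK.
apply/setP => v; rewrite in_setD childrenE /roots !in_set e1 e2; apply/andP/eqP => [|pv].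
  case; case: (T v) => [w|]; rewrite ?andbT ?lt.
    rewrite negb_and -ltnNge -leqNgt => /orP [uv|wu] /andP [vu uw].
      by move: vu; rewrite leqNgt lt (ltnW uv).
    by congr Some; apply: val_inj; apply/eqP; rewrite eqn_leq wu.
  by rewrite -ltnNge => uv; rewrite leqNgt lt (ltnW uv).
by rewrite pv ltnn andbF lt leqnn andbT -ltnS prednK // (parent_gt pv).
Qed.

Lemma tree_stage_born u : n < u ->
  blocks (tree_stage (u - n)) :\: blocks (tree_stage (u - n).-1) = [set leaf_set u].
Proof.
by move=> nu; rewrite !tree_stageE -(imset_setD _ _ leaf_set_inj) roots_born ?imset_set1.
Qed.

Lemma tree_stage_dead u : n < u ->
  blocks (tree_stage (u - n).-1) :\: blocks (tree_stage (u - n)) = leaf_set @: children T u.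
Proof.
by move=> nu; rewrite !tree_stageE -(imset_setD _ _ leaf_set_inj) roots_dead.
Qed.

Lemma tree_stage_merges u c1 c2 : n < u -> c1 != c2 -> children T u = [set c1; c2] ->
  merges (tree_stage (u - n).-1) (tree_stage (u - n)) (leaf_set c1) (leaf_set c2).
Proof.
move=> nu ne ec; have eD := tree_stage_dead nu; have eB := tree_stage_born nu.
rewrite ec imsetU1 imset_set1 in eD.
have ind B : B \in [set leaf_set c1; leaf_set c2] -> B \in blocks (tree_stage (u - n).-1).
  by rewrite -eD inE => /andP [].
split; [by apply: ind; rewrite !inE eqxx|by apply: ind; rewrite !inE eqxx orbT| |].
  by rewrite (inj_eq leaf_set_inj).
rewrite -(leaf_set_internal nu ec) -eB -eD; apply/setP => B; rewrite !in_setU !in_setD.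
by case: (B \in blocks (tree_stage (u - n).-1)); case: (B \in blocks (tree_stage (u - n))).
Qed.

Lemma vertex_of k : 0 < k <= n -> exists2 u : V, n < u & k = u - n.
Proof.
case/andP => k0 kn; have lt : n + k < n.*2.+1 by rewrite ltnS -addnn leq_add2l.
by exists (Ordinal lt); rewrite /= ?addKn // -[X in X < _]addn0 ltn_add2l.
Qed.

Lemma tree_step k : k < n -> step (tree_stage k) (tree_stage k.+1).
Proof.
move=> kn; have [u nu e] : exists2 u : V, n < u & k.+1 = u - n by apply: vertex_of.
have [c1 [c2 [ne ec]]] := children_internal nu.
by have := merges_step (tree_stage_merges nu ne ec); rewrite -e.
Qed.

Lemma tree_stage0 : tree_stage 0 = \bot%O.
Proof.
apply/eqP; rewrite -lex0; apply/leP_blocks => B; rewrite tree_stageE => /imsetP [r].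
rewrite inE addn0 => /andP [/leafP [j ->] _] ->; rewrite leaf_set_leaf.
by have [C Cb jC] := block_ex \bot%O j; exists C; rewrite ?sub1set.
Qed.

Lemma tree_chain_max : maxset (@is_chain _ SP) (tree_chain T).
Proof. exact: seq_chain_max tree_stage0 tree_step. Qed.

Definition chain_of_tree : max_chain SP := MaxChain tree_chain_max.

Lemma stage_tree k : k <= n -> stage chain_of_tree k = tree_stage k.
Proof. exact: stage_seq tree_stage0 tree_step _ _ _. Qed.

Lemma min_label_leaves u : min_label (leaves T u) = min_label (leaf_set u).
Proof.
have [j0 j0u] := leaf_set_mem u; have [j hj] := block_min_ex j0u.
rewrite (min_labelE hj); case/block_minP: hj => ju hj.
apply: (@min_labelE _ _ (leaf_vertex j)); apply/block_minP; split=> [|v].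
  by rewrite inE leafE leaf_vertex_le; move: ju; rewrite inE.
rewrite inE leafE => /andP [/leafP [i ->] ui] /=.
by apply: hj; rewrite inE.
Qed.

Lemma max_min_leavesE u : n < u ->
  max_min_leaves T u = max_min (tree_stage (u - n).-1) (tree_stage (u - n)).
Proof.
move=> nu; rewrite /max_min tree_stage_dead // big_imset /=; last by move=> x y _ _; apply: leaf_set_inj.
by apply: eq_bigr => c _; apply: min_label_leaves.
Qed.

End Tree.

(** * The tree of a partition sequence *)

Lemma setD_rebuild (U : finType) (A A' : {set U}) : A' = (A :\: (A :\: A')) :|: (A' :\: A).
Proof. by apply/setP => x; rewrite !inE; case: (x \in A); case: (x \in A'). Qed.

Lemma cover2 (U : finType) (A B : {set U}) : cover [set A; B] = A :|: B.
Proof. by rewrite /cover bigcup_setU !big_set1. Qed.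

Section TreeOfSeq.
Context (n : nat).
Local Notation V := 'I_(n.*2.+1).
Local Notation SP := (set_partition 'I_n.+1).
Context (X : nat -> SP).
Hypotheses (X0 : X 0 = \bot%O) (XS : forall j, j < n -> step (X j) (X j.+1)).
Implicit Types (u v w r c : V) (k : nat).

(** What the leaf set of v has to be, see [leaf_set_tree_of_seq]. *)
Definition newborn v : {set 'I_n.+1} :=
  if v <= n then [set inord v]
  else odflt set0 [pick B in blocks (X (v - n)) :\: blocks (X (v - n).-1)].

Definition dying u := blocks (X (u - n).-1) :\: blocks (X (u - n)).

Lemma seq_step_birth u : n < u -> step (X (u - n).-1) (X (u - n)).
Proof.
move=> nu; have u0 : 0 < u - n by rewrite subn_gt0.
have := @XS (u - n).-1; rewrite prednK //; apply.
by rewrite leq_subLR addnn -ltnS ltn_ord.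
Qed.

Lemma birth_le v : v - n <= n.
Proof. by rewrite leq_subLR addnn -ltnS ltn_ord. Qed.

Lemma newbornE u : n < u -> blocks (X (u - n)) :\: blocks (X (u - n).-1) = [set newborn u].
Proof.
move=> nu; have [B [C m]] := step_merges (seq_step_birth nu); rewrite (merges_born m).
rewrite /newborn leqNgt nu /= (merges_born m); case: pickP => [D|/(_ (B :|: C))].
  by rewrite inE => /eqP ->.
by rewrite inE eqxx.
Qed.

Lemma bot_blocks (B : {set 'I_n.+1}) :
  reflect (exists j, B = [set j]) (B \in blocks (\bot%O : SP)).
Proof.
have e (j : 'I_n.+1) : [set y in setT | j == y] = [set j].
  by apply/setP => i; rewrite !inE eq_sym.
apply: (iffP imsetP) => [[j _ ->]|[j ->]]; first by exists j; rewrite e.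
by exists j; rewrite ?e.
Qed.

Lemma newborn_leaf (j : 'I_n.+1) : newborn (leaf_vertex j) = [set j].
Proof. by rewrite /newborn /= -ltnS ltn_ord inord_val. Qed.

Lemma newborn_in v : newborn v \in blocks (X (v - n)).
Proof.
have [vn|nv] := leqP v n.
  have -> : v - n = 0 by apply/eqP; rewrite subn_eq0.
  by rewrite X0 /newborn vn; apply/bot_blocks; eexists.
by have := set11 (newborn v); rewrite -newbornE // inE => /andP [].
Qed.

Lemma newborn_notin v : n < v -> newborn v \notin blocks (X (v - n).-1).
Proof.
by move=> nv; have := set11 (newborn v); rewrite -newbornE // inE => /andP [].
Qed.

(** Blocks only grow, so a block that is present at two stages is present at
    all stages in between. Hence it is merged only once, which makes the parent
    chosen by [seq_parent] unique. *)
Lemma dead_forever B i j k : i <= j -> j <= k -> k <= n ->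
  B \in blocks (X i) -> B \in blocks (X k) -> B \in blocks (X j).
Proof.
move=> ij jk kn Bi Bk; have [a aB] := block_mem Bi.
have [D Dj aD] := block_ex (X j) a.
have h1 := le_block_sub (seq_le XS ij (leq_trans jk kn)) Bi Dj aB aD.
have h2 := le_block_sub (seq_le XS jk kn) Dj Bk aD aB.
by suff -> : B = D by []; apply/eqP; rewrite eqEsubset h1.
Qed.

Lemma newborn_ltn v w : v < w -> newborn v != newborn w.
Proof.
move=> vw; apply/eqP => e; have [wn|nw] := leqP w n.
  move: e; rewrite /newborn wn (leq_trans (ltnW vw) wn) => /set1_inj /(congr1 val) /=.
  by rewrite !inordK ?ltnS // ?(leq_trans (ltnW vw)) // => e; rewrite e ltnn in vw.
case/negP: (newborn_notin nw).
apply: (dead_forever (i := v - n) _ _ (birth_le w) _ (newborn_in w)).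
- by rewrite -ltnS prednK ?subn_gt0 // ltn_sub2r.
- exact: leq_pred.
- by rewrite -e newborn_in.
Qed.

Lemma newborn_inj : injective newborn.
Proof.
move=> v w e; apply: val_inj; case: (ltngtP v w) => // /newborn_ltn.
  by rewrite e eqxx.
by rewrite e eqxx.
Qed.

Lemma newborn_onto k B : k <= n -> B \in blocks (X k) -> exists2 v : V, v <= n + k & newborn v = B.
Proof.
elim: k B => [|k IH] B kn.
  rewrite X0 => /bot_blocks [j ->]; exists (leaf_vertex j); last exact: newborn_leaf.
  by rewrite addn0 leaf_vertex_le.
move=> Bk; have [Bk'|Bk'] := boolP (B \in blocks (X k)).
  have [v vk <-] := IH B (ltnW kn) Bk'; exists v => //.
  by rewrite addnS leqW.
have [u nu e] : exists2 u : V, n < u & k.+1 = u - n by apply: vertex_of.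
have : B \in blocks (X k.+1) :\: blocks (X k) by rewrite inE Bk' Bk.
rewrite e -[k]/(k.+1.-1) e newbornE // inE => /eqP ->; exists u => //.
by rewrite subnKC // ltnW.
Qed.

Definition seq_parent : {ffun V -> option V} :=
  [ffun v => [pick u : V | (n < u) && (newborn v \in dying u)]].

Lemma seq_parentE v u : (seq_parent v == Some u) = (n < u) && (newborn v \in dying u).
Proof.
have uniq u1 u2 : n < u1 -> newborn v \in dying u1 -> n < u2 -> newborn v \in dying u2 ->
    u1 < u2 -> False.
  move=> n1; rewrite inE => /andP [d1 a1] n2; rewrite inE => /andP [d2 a2] lt.
  case/negP: d1; apply: (dead_forever _ _ _ a1 a2); first exact: leq_pred.
    by rewrite -ltnS prednK ?subn_gt0 // ltn_sub2r.
  exact: leq_trans (leq_pred _) (birth_le u2).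
rewrite ffunE; case: pickP => [u' /andP [nu' du']|no]; last by rewrite no.
apply/eqP/andP => [[<-] //|[nu du]]; congr Some; apply: val_inj.
case: (ltngtP u' u) => // lt; exfalso; first exact: (uniq u' u).
exact: (uniq u u').
Qed.

Lemma seq_parent_lt v u : seq_parent v = Some u -> v < u.
Proof.
move/eqP; rewrite seq_parentE => /andP [nu]; rewrite inE => /andP [_ a].
rewrite ltnNge; apply/negP => uv; have nv := leq_trans nu uv.
case/negP: (newborn_notin nv).
apply: (dead_forever _ _ (birth_le v) a (newborn_in v)); last exact: leq_pred.
by rewrite -!subn1 leq_sub2r // leq_sub2r.
Qed.

Lemma seq_children u : n < u -> newborn @: children seq_parent u = dying u.
Proof.
move=> nu; apply/setP => B; apply/imsetP/idP => [[v]|dB].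
  by rewrite inE seq_parentE nu /= => h ->.
have : B \in blocks (X (u - n).-1) by move: dB; rewrite inE => /andP [].
case/newborn_onto => [|v _ e]; first exact: leq_trans (leq_pred _) (birth_le u).
by exists v; rewrite // inE seq_parentE nu e.
Qed.

Lemma seq_children_leaf u : u <= n -> children seq_parent u = set0.
Proof. by move=> un; apply/setP => v; rewrite !inE seq_parentE ltnNge un. Qed.

Lemma seq_children_card u : n < u -> #|children seq_parent u| = 2.
Proof.
move=> nu; rewrite -(card_imset _ newborn_inj) (seq_children nu) /dying.
by have [B [C m]] := step_merges (seq_step_birth nu); rewrite (merges_dead m) cards2; case: m => _ _ ->.
Qed.

Lemma seq_leaf u : is_leaf seq_parent u = (u <= n).
Proof.
rewrite /is_leaf; have [un|nu] := leqP u n; first by rewrite seq_children_leaf ?eqxx.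
by rewrite -cards_eq0 seq_children_card.
Qed.

(** Every block other than the whole set dies before the last stage; the parent
    is found at the first stage where it is missing. *)
Lemma seq_root v : v != ord_max -> exists u, seq_parent v = Some u.
Proof.
move=> vr; have bn : (ord_max : V) - n = n by rewrite /= -addnn addnK.
have dn : newborn v \notin blocks (X n).
  apply: contra vr => bv; apply/eqP/newborn_inj.
  have := newborn_in ord_max; rewrite bn => br.
  have := seq_card X0 XS (leqnn n); rewrite subSnn => /eqP /cards1P [B e].
  by move: bv br; rewrite e !inE => /eqP -> /eqP ->.
have ex : exists k, (v - n <= k) && (newborn v \notin blocks (X k)).
  by exists n; rewrite birth_le.
case: (ex_minnP ex) => k /andP [vk dk] mk.
have kn : k <= n by apply: mk; rewrite birth_le.
have nk : v - n != k by apply: contraNneq dk => <-; apply: newborn_in.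
have k0 : 0 < k by apply: leq_ltn_trans (leq0n (v - n)) _; rewrite ltn_neqAle nk.
have [u nu e] : exists2 u : V, n < u & k = u - n by apply: vertex_of; rewrite k0.
exists u; apply/eqP; rewrite seq_parentE nu inE -e dk /=.
apply: contraT => dk'; have := mk k.-1; rewrite dk' andbT.
have -> : v - n <= k.-1 by rewrite -ltnS prednK // ltn_neqAle nk.
by move/(_ isT); rewrite leqNgt prednK // leqnn.
Qed.

Lemma seq_tree_axiom : [&& rooted_tree seq_parent, full_binary seq_parent,
  decreasing seq_parent & [forall v, is_leaf seq_parent v == (label v <= n.+1)]].
Proof.
apply/and4P; split.
- apply/existsP; exists ord_max; apply/andP; split.
    case e : (seq_parent ord_max) => [u|//]; have := seq_parent_lt e.
    by rewrite ltnNge -ltnS ltn_ord.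
  apply/forallP => v; elim/ltn_ind: {v}(n.*2 - v) {-2}v (erefl (n.*2 - v)) => m IH v em.
  have [->|vr] := eqVneq v ord_max; first exact: connect0.
  have [u pu] := seq_root vr; have vu := seq_parent_lt pu.
  apply: (connect_trans (IH (n.*2 - u) _ u erefl)); last by apply: connect1; rewrite pu.
  by rewrite -em ltn_sub2l // (leq_trans vu) // -ltnS ltn_ord.
- apply/forallP => u; apply/implyP; rewrite seq_leaf -ltnNge => nu.
  by rewrite seq_children_card.
- apply/forallP => u; apply/forallP => v; apply/implyP => /andP [uv vu].
  rewrite /label ltnS ltn_neqAle (inj_eq val_inj) vu /=.
  apply: (connect_ind (Q := fun v => v <= u) _ _ uv) => // a b au /eqP /seq_parent_lt ba.
  exact: leq_trans (ltnW ba) au.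
- by apply/forallP => v; rewrite seq_leaf.
Qed.

Definition tree_of_seq : PT n := PTree seq_tree_axiom.

(** By induction along the labels: the children of v carry the two blocks that
    die when the block of v is born. *)
Lemma leaf_set_tree_of_seq v : leaf_set tree_of_seq v = newborn v.
Proof.
elim/ltn_ind: {v}(v : nat) {-2}v (erefl (v : nat)) => m IH v ev.
have [/leafP [j ->]|nv] := leqP v n; first by rewrite leaf_set_leaf newborn_leaf.
have [c1 [c2 [ne ec]]] := children_internal tree_of_seq nv.
have lt c : c \in [set c1; c2] -> c < m.
  by rewrite -ec inE => /eqP /seq_parent_lt; rewrite ev.
rewrite (leaf_set_internal nv ec) !(IH _ (lt _ _) _ erefl) ?inE ?eqxx ?orbT //.
have -> : newborn c1 :|: newborn c2 = cover (dying v).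
  by rewrite -(seq_children nv) [children _ _]ec imsetU1 imset_set1 cover2.
have [B [C m']] := step_merges (seq_step_birth nv); apply: set1_inj.
by rewrite -(newbornE nv) /dying (merges_dead m') (merges_born m') cover2.
Qed.

Lemma tree_of_seq_stage k : k <= n -> tree_stage tree_of_seq k = X k.
Proof.
elim: k => [|k IH] kn; first by rewrite tree_stage0 X0.
have [u nu e] : exists2 u : V, n < u & k.+1 = u - n by apply: vertex_of.
have := IH (ltnW kn); rewrite -[k]/(k.+1.-1) e => IHk.
apply: val_inj => /=; rewrite [LHS](setD_rebuild (tree_stage tree_of_seq (u - n).-1)).
rewrite (tree_stage_born _ nu) (tree_stage_dead _ nu) leaf_set_tree_of_seq (eq_imset _ leaf_set_tree_of_seq).
by rewrite (seq_children nu) -(newbornE nu) IHk -setD_rebuild.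
Qed.

End TreeOfSeq.

(** * Tree moves as changes of one stage *)

Lemma option_eqP (V : eqType) (x y : option V) :
  (forall u, (x == Some u) = (y == Some u)) -> x = y.
Proof.
case: x => [a|] h; first by apply/esym/eqP; rewrite -h.
by case: y h => // b /(_ b); rewrite eqxx.
Qed.

Section Moves.
Context (n : nat).
Local Notation V := 'I_(n.*2.+1).
Local Notation SP := (set_partition 'I_n.+1).
Implicit Types (T S : PT n) (u v w r c : V) (i k : nat).

Lemma leaf_set_children T u v : (leaf_set T v \in leaf_set T @: children T u) = (T v == Some u).
Proof. by rewrite mem_imset ?childrenE //; apply: leaf_set_inj. Qed.

Lemma no_parent_leaf T u v : u <= n -> (T v == Some u) = false.
Proof.
by move=> un; apply/eqP => /parent_internal; rewrite ltnNge un.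
Qed.

Lemma children_other T u c : c \in children T u ->
  exists d, c != d /\ children T u = [set c; d].
Proof.
move=> cu; have pc : T c = Some u by apply/eqP; rewrite -childrenE.
have [c1 [c2 [ne e]]] := children_internal T (parent_internal pc).
move: cu; rewrite e !inE => /orP [] /eqP ->; first by exists c2.
by exists c1; rewrite eq_sym ne setUC.
Qed.

(** With T = S this merely says that stages i - 1, i and i + 1 make sense; that
    instance is used before the second tree is known. *)
Definition agree_off i T S :=
  0 < i < n /\ forall j, j <= n -> j != i -> tree_stage T j = tree_stage S j.

Section Agree.
Context (T S : PT n) (i : nat) (a b : V).
Hypotheses (TS : agree_off i T S) (ea : a = n + i :> nat) (eb : b = n + i.+1 :> nat).

Let i0 : 0 < i. Proof. by case: TS => /andP []. Qed.
Let iN : i < n. Proof. by case: TS => /andP []. Qed.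
Let ag j : j <= n -> j != i -> tree_stage T j = tree_stage S j.
Proof. by case: TS => _; apply. Qed.

Lemma internal_a : n < a. Proof. by rewrite ea -[X in X < _]addn0 ltn_add2l. Qed.
Lemma internal_b : n < b. Proof. by rewrite eb -[X in X < _]addn0 ltn_add2l. Qed.
Lemma birth_a : a - n = i. Proof. by rewrite ea addKn. Qed.
Lemma birth_b : b - n = i.+1. Proof. by rewrite eb addKn. Qed.
Lemma a_neq_b : a != b.
Proof. by rewrite -(inj_eq val_inj) /= ea eb eqn_add2l neq_ltn leqnn. Qed.
Lemma ag_pred : tree_stage T i.-1 = tree_stage S i.-1.
Proof.
by apply: ag; [apply: leq_trans (leq_pred i) (ltnW iN)|case: (i) i0 => // k _; rewrite neq_ltn leqnn].
Qed.
Lemma ag_succ : tree_stage T i.+1 = tree_stage S i.+1.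
Proof. by apply: ag => //; rewrite neq_ltn leqnn orbT. Qed.

Lemma other_birth u : n < u -> u != a -> u != b ->
  tree_stage T (u - n) = tree_stage S (u - n) /\
  tree_stage T (u - n).-1 = tree_stage S (u - n).-1.
Proof.
move=> nu ua ub.
have h k : u != k :> nat -> n <= k -> u - n != k - n.
  by move=> uk nk; apply: contraNneq uk => e; rewrite -(subnKC (ltnW nu)) e subnKC.
have ha : u - n != i by rewrite -birth_a h // ltnW // internal_a.
have hb : u - n != i.+1 by rewrite -birth_b h // ltnW // internal_b.
split; apply: ag => //; first exact: birth_le.
  exact: leq_trans (leq_pred _) (birth_le u).
by apply: contraNneq hb => <-; rewrite prednK // subn_gt0.
Qed.

Lemma leaf_set_other u : u != a -> u != b -> leaf_set S u = leaf_set T u.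
Proof.
move=> ua ub; have [/leafP [j ->]|nu] := leqP u n; first by rewrite !leaf_set_leaf.
have [e1 e2] := other_birth nu ua ub.
by apply: set1_inj; rewrite -(tree_stage_born S nu) -e1 -e2 tree_stage_born.
Qed.

Lemma dead_other u : n < u -> u != a -> u != b ->
  leaf_set S @: children S u = leaf_set T @: children T u.
Proof.
move=> nu ua ub; have [e1 e2] := other_birth nu ua ub.
by rewrite -(tree_stage_dead S nu) -e1 -e2 tree_stage_dead.
Qed.

Lemma born_a B C : merges (tree_stage T i.-1) (tree_stage S i) B C ->
  leaf_set S a = B :|: C /\ leaf_set S @: children S a = [set B; C].
Proof.
move=> m; have := tree_stage_born S internal_a; have := tree_stage_dead S internal_a; rewrite birth_a -ag_pred.
by rewrite (merges_dead m) (merges_born m) => -> /set1_inj ->.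
Qed.

Lemma born_b B C : merges (tree_stage S i) (tree_stage T i.+1) B C ->
  leaf_set S b = B :|: C /\ leaf_set S @: children S b = [set B; C].
Proof.
move=> m; have := tree_stage_born S internal_b; have := tree_stage_dead S internal_b; rewrite birth_b -ag_succ.
by rewrite (merges_dead m) (merges_born m) => -> /set1_inj ->.
Qed.

Lemma merges_a c1 c2 : c1 != c2 -> children T a = [set c1; c2] ->
  merges (tree_stage T i.-1) (tree_stage T i) (leaf_set T c1) (leaf_set T c2).
Proof. by move=> ne e; rewrite -birth_a; apply: tree_stage_merges => //; apply: internal_a. Qed.

Lemma merges_b c1 c2 : c1 != c2 -> children T b = [set c1; c2] ->
  merges (tree_stage T i) (tree_stage T i.+1) (leaf_set T c1) (leaf_set T c2).
Proof.
move=> ne e; have := tree_stage_merges internal_b ne e; by rewrite birth_b.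
Qed.

Lemma step_a : step (tree_stage T i.-1) (tree_stage S i).
Proof.
rewrite ag_pred; have := @tree_step n S i.-1; rewrite prednK //; apply; exact: ltnW.
Qed.

Lemma step_b : step (tree_stage S i) (tree_stage T i.+1).
Proof. by rewrite ag_succ; apply: tree_step. Qed.

Lemma alive_a : a \notin children T b -> leaf_set T a \in blocks (tree_stage T i.+1).
Proof.
apply: contraNT => h'; have h : leaf_set T a \in blocks (tree_stage T i).
  have [c1 [c2 [nc ec]]] := children_internal T internal_a.
  by rewrite (leaf_set_internal internal_a ec) (merges_new (merges_a nc ec)).
have : leaf_set T a \in blocks (tree_stage T i) :\: blocks (tree_stage T i.+1).
  by rewrite inE h' h.
by have := tree_stage_dead T internal_b; rewrite birth_b /= => ->; rewrite leaf_set_children childrenE.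
Qed.

(** The middle element of the interval is determined, so S performs the two
    merges of T in the opposite order. Then the leaf sets of S are those of T
    relabelled, and leaf sets determine the parents. *)
Lemma swap_disjoint : tree_stage S i != tree_stage T i -> a \notin children T b ->
  parent S = swap_labels T a b.
Proof.
move=> ne nab.
have [c1 [c2 [nc ec]]] := children_internal T internal_a.
have [d1 [d2 [nd ed]]] := children_internal T internal_b.
have m1 := merges_a nc ec; have m2 := merges_b nd ed.
have Uz : leaf_set T c1 :|: leaf_set T c2 \in blocks (tree_stage T i.+1).
  by rewrite -(leaf_set_internal internal_a ec) alive_a.
have m3 := diamond_disjoint_other m1 m2 Uz step_a (ltW (step_lt step_b)) ne.
have m4 := diamond_disjoint m1 m2 Uz m3.
have [la da] := born_a m3; have [lb db] := born_b m4.
rewrite -(leaf_set_internal internal_b ed) in la; rewrite -(leaf_set_internal internal_a ec) in lb.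
have lt u : leaf_set S u = leaf_set T (tperm a b u).
  by case: tpermP => [->|->|/eqP ua /eqP ub] //; apply: leaf_set_other.
have dt u : n < u -> leaf_set S @: children S u = leaf_set T @: children T (tperm a b u).
  move=> nu; case: tpermP => [->|->|/eqP ua /eqP ub]; last exact: dead_other.
    by rewrite da ed imsetU1 imset_set1.
  by rewrite db ec imsetU1 imset_set1.
apply/ffunP => v; rewrite ffunE; apply: option_eqP => u.
have -> : (omap (tperm a b) (T (tperm a b v)) == Some u) = (T (tperm a b v) == Some (tperm a b u)).
  by case: (T _) => [w|//] /=; rewrite !(inj_eq Some_inj) -(inj_eq (@perm_inj _ (tperm a b))) tpermK.
have [un|nu] := leqP u n.
  rewrite !no_parent_leaf // tpermD //; rewrite -(inj_eq val_inj) neq_ltn.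
    by rewrite (leq_ltn_trans un internal_a) orbT.
  by rewrite (leq_ltn_trans un internal_b) orbT.
by rewrite -!leaf_set_children -lt dt.
Qed.

(** Only the leaf set of a changes, and with it the children of a and b. *)
Lemma swap_nested z0 z1 w : z0 != z1 -> children T a = [set z0; z1] ->
  a != w -> children T b = [set a; w] ->
  merges (tree_stage T i.-1) (tree_stage S i) (leaf_set T w) (leaf_set T z1) ->
  parent S = swap_subtrees T w z0.
Proof.
move=> nz ez nw ew m3.
have m1 : merges (tree_stage T i.-1) (tree_stage T i) (leaf_set T z1) (leaf_set T z0).
  exact/merges_sym/merges_a.
have m2 := merges_b nw ew.
rewrite (leaf_set_internal internal_a ez) setUC in m2.
have m4 := diamond_nested m1 m2 m3.
have [la da] := born_a m3; have [lb db] := born_b m4; rewrite -la in db.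
have pz0 : T z0 = Some a by apply/eqP; rewrite -childrenE ez !inE eqxx.
have pz1 : T z1 = Some a by apply/eqP; rewrite -childrenE ez !inE eqxx orbT.
have pa : T a = Some b by apply/eqP; rewrite -childrenE ew !inE eqxx.
have pw : T w = Some b by apply/eqP; rewrite -childrenE ew !inE eqxx orbT.
have ab : a < b := parent_gt pa.
have small (x y : V) : x < y -> x != y by move=> l; rewrite -(inj_eq val_inj) neq_ltn l.
have z0a := small _ _ (parent_gt pz0); have z1a := small _ _ (parent_gt pz1).
have z0b := small _ _ (ltn_trans (parent_gt pz0) ab).
have z1b := small _ _ (ltn_trans (parent_gt pz1) ab).
have wb := small _ _ (parent_gt pw); have wa : w != a by rewrite eq_sym.
have lvE v : v != a -> leaf_set S v = leaf_set T v.
  have [->|vb va] := eqVneq v b; last exact: leaf_set_other.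
  move=> _; rewrite lb (leaf_set_internal internal_b ew) (leaf_set_internal internal_a ez); apply/setP => j.
  by rewrite !in_setU; do 3!case: (_ \in _).
have chS v u : (S v == Some u) = (leaf_set S v \in leaf_set S @: children S u) by rewrite leaf_set_children.
have chT v u : (T v == Some u) = (leaf_set T v \in leaf_set T @: children T u) by rewrite leaf_set_children.
have zw : z0 != w by apply: contra_eq_neq pz0 => ->; rewrite pw; apply/eqP => -[e]; move: ab; rewrite e ltnn.
have zw1 : z1 != w by apply: contra_eq_neq pz1 => ->; rewrite pw; apply/eqP => -[e]; move: ab; rewrite e ltnn.
have Sa v : (S v == Some a) = (v == w) || (v == z1).
  by rewrite chS da -(lvE w wa) -(lvE z1 z1a) in_set2 !(inj_eq (@leaf_set_inj _ _)).
have Sb v : (S v == Some b) = (v == a) || (v == z0).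
  by rewrite chS db -(lvE z0 z0a) in_set2 !(inj_eq (@leaf_set_inj _ _)).
have Ta v : (T v == Some a) = (v == z0) || (v == z1) by rewrite -childrenE ez !inE.
have Tb v : (T v == Some b) = (v == a) || (v == w) by rewrite -childrenE ew !inE.
have So v u : u != a -> u != b -> (S v == Some u) = (T v == Some u).
  move=> ua ub; have [un|nu] := leqP u n; first by rewrite !no_parent_leaf.
  have [->|va] := eqVneq v a.
    have /eqP -> : S a == Some b by rewrite Sb eqxx.
    by rewrite pa.
  by rewrite chS dead_other // lvE // -chT.
apply/ffunP => v; rewrite ffunE; apply: option_eqP => u.
have [->|ua] := eqVneq u a.
  rewrite Sa Ta; case: tpermP => [->|->|/eqP vw /eqP vz].
  - by rewrite !eqxx.
  - by rewrite (negbTE zw) (negbTE nz) eq_sym (negbTE zw) eq_sym (negbTE zw1).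
  - by rewrite (negbTE vw) (negbTE vz).
have [->|ub] := eqVneq u b.
  rewrite Sb Tb; case: tpermP => [->|->|/eqP vw /eqP vz].
  - by rewrite (negbTE wa) [w == z0]eq_sym (negbTE zw) (negbTE z0a).
  - by rewrite !eqxx !orbT.
  - by rewrite (negbTE vw) (negbTE vz).
rewrite So //; case: tpermP => [->|->|//].
- by rewrite pw pz0 !(inj_eq Some_inj) ![_ == u]eq_sym (negbTE ua) (negbTE ub).
- by rewrite pw pz0 !(inj_eq Some_inj) ![_ == u]eq_sym (negbTE ua) (negbTE ub).
Qed.

End Agree.

(** Any change of the chain at one rank is realised by a tree, because every
    partition sequence comes from a tree. *)
Lemma stage_variation T i y : 0 < i < n ->
  step (tree_stage T i.-1) y -> step y (tree_stage T i.+1) ->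
  exists2 S, agree_off i T S & tree_stage S i = y.
Proof.
move=> iN s1 s2; pose X j := if j == i then y else tree_stage T j.
case/andP: (iN) => i0 i_n.
have X0 : X 0 = \bot%O by rewrite /X eq_sym -[i == 0]negbK -lt0n i0 tree_stage0.
have XS j : j < n -> step (X j) (X j.+1).
  move=> jn; rewrite /X; have [->|ji] := eqVneq j i.
    by have -> : (i.+1 == i) = false by apply/eqP => e; move: (ltnn i); rewrite -{2}e ltnSn.
  have [e|ji'] := eqVneq j.+1 i; first by rewrite -e in s1.
  exact: tree_step.
exists (tree_of_seq X0 XS); last by rewrite tree_of_seq_stage /X ?eqxx // ltnW.
by split=> // j jn ji; rewrite tree_of_seq_stage /X ?(negbTE ji).
Qed.

Definition tree_chain_move T S i :=
  [/\ agree_off i T S, tree_stage T i != tree_stage S i &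
      max_min (tree_stage T i.-1) (tree_stage T i) <
      max_min (tree_stage T i) (tree_stage T i.+1)].

Lemma chain_move_tree T S i :
  chain_move (chain_of_tree T) (chain_of_tree S) i <-> tree_chain_move T S i.
Proof.
have h : 0 < i < n -> [/\ i.-1 <= n, i <= n & i.+1 <= n].
  by case/andP => i0 iN; split=> //; [apply: leq_trans (leq_pred i) _|]; apply: ltnW.
split=> [[iN ag ne lt]|[[iN ag] ne lt]]; have [h1 h2 h3] := h iN.
  rewrite !stage_tree // in ne lt; split=> //; split=> // j jn ji.
  by have := ag j jn ji; rewrite !stage_tree.
split=> [//|j jn ji||].
- by rewrite !stage_tree //; apply: ag.
- by rewrite !(stage_tree _ h2).
- by rewrite (stage_tree _ h1) (stage_tree _ h2) (stage_tree _ h3).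
Qed.

(** From left to right, the leaf sets of S are not computed: the partition
    obtained by the other merge is realised by some tree S', and the swap
    lemmas show that S' has the parent function prescribed for S. *)
Lemma tree_moveP T S :
  reflect (exists i, tree_chain_move T S i) (tree_move T S).
Proof.
apply: (iffP existsP) => [[i /existsP [a /existsP [b]]]|[i [ag ne lt]]].
  case/and5P => /andP [i0 _] /eqP la /eqP lb mv lt.
  have iN : i < n by apply: ltn_ord.
  have i0N : 0 < i < n by rewrite i0.
  have ea : a = n + i :> nat by move: la; rewrite /label addn1 addSn => -[].
  have eb : b = n + i.+1 :> nat by move: lb; rewrite /label !addn1 addSn addnS => -[].
  have ag0 : agree_off i T T by split.
  have Na := internal_a ag0 ea; have Nb := internal_b eb.
  rewrite (max_min_leavesE T Na) (max_min_leavesE T Nb) (birth_a ea) (birth_b eb) /= in lt.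
  exists i.
  suff [S' ag' [ne' e']] : exists2 S', agree_off i T S' &
      tree_stage T i != tree_stage S' i /\ parent S = parent S'.
    by have -> : S = S' by apply: val_inj.
  case/orP: mv => [/eqP sw|/andP [ab /exists_inP [w wb /exists_inP [z za /eqP sw]]]].
    have nab : a \notin children T b.
      rewrite childrenE; apply/negP => /eqP pa.
      have /parent_gt : S b = Some a by rewrite sw ffunE tpermR pa /= tpermR.
      by rewrite ea eb ltn_add2l ltnNge leqnSn.
    have [c1 [c2 [nc ec]]] := children_internal T Na.
    have [d1 [d2 [nd ed]]] := children_internal T Nb.
    have m1 := merges_a ag0 ea nc ec; have m2 := merges_b eb nd ed.
    have Uz : leaf_set T c1 :|: leaf_set T c2 \in blocks (tree_stage T i.+1).
      by rewrite -(leaf_set_internal Na ec) (alive_a ag0 ea eb).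
    have old d : d \in children T b -> leaf_set T d \in blocks (tree_stage T i) ->
        leaf_set T d \in blocks (tree_stage T i.-1).
      move=> db; rewrite (merges_in m1) -(leaf_set_internal Na ec) => /orP [/eqP /leaf_set_inj e|/and3P [] //].
      by rewrite -e db in nab.
    have [y m3] : exists y, merges (tree_stage T i.-1) y (leaf_set T d1) (leaf_set T d2).
      case: m2 => d1y d2y dn _.
      by apply: merge_ex => //; apply: old => //; rewrite ed !inE eqxx ?orbT.
    have m4 := diamond_disjoint m1 m2 Uz m3.
    have [S' ag' e] := stage_variation i0N (merges_step m3) (merges_step m4).
    have ne' : tree_stage T i != tree_stage S' i.
      rewrite e; apply/eqP => e'; have := merges_born m3; rewrite -e' (merges_born m1).
      move/set1_inj; rewrite -(leaf_set_internal Na ec) -(leaf_set_internal Nb ed) => /leaf_set_inj.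
      exact/eqP/(a_neq_b ea eb).
    exists S' => //; split=> //; rewrite sw; apply/esym/(swap_disjoint ag' ea eb) => //.
    by rewrite eq_sym.
  have [z1 [nz ez]] := children_other za.
  have [w' [nw ew]] := children_other ab.
  have ew' : w' = w.
    by move: wb; rewrite in_setD1 ew !inE => /andP [/negbTE ->] /= /eqP.
  subst w'.
  have m1 := merges_a ag0 ea nz ez; have m2 := merges_b eb nw ew.
  have pz1 : T z1 = Some a by apply/eqP; rewrite -childrenE ez !inE eqxx orbT.
  have pw : T w = Some b by apply/eqP; rewrite -childrenE ew !inE eqxx orbT.
  have wz1 : w != z1.
    apply/eqP => e; rewrite e pz1 in pw; case: pw; exact/eqP/(a_neq_b ea eb).
  have [y m3] : exists y, merges (tree_stage T i.-1) y (leaf_set T w) (leaf_set T z1).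
    apply: merge_ex; last by rewrite (inj_eq (@leaf_set_inj _ _)).
      case: m2 => _ wy _ _; move: wy; rewrite (merges_in m1) -(leaf_set_internal Na ez).
      by case/orP => [/eqP /leaf_set_inj e|/and3P [] //]; rewrite e eqxx in nw.
    by case: m1.
  have m1' := merges_sym m1; have m2' := m2; rewrite (leaf_set_internal Na ez) setUC in m2'.
  have m4 := diamond_nested m1' m2' m3.
  have [S' ag' e] := stage_variation i0N (merges_step m3) (merges_step m4).
  have ne' : tree_stage T i != tree_stage S' i.
    rewrite e; apply/eqP => e'; have := merges_dead m3; rewrite -e' (merges_dead m1).
    move/setP/(_ (leaf_set T w)); rewrite !inE !(inj_eq (@leaf_set_inj _ _)) eqxx (negbTE wz1) orbF => /eqP ez'.
    rewrite ez' in pw; move: za; rewrite childrenE pw => /eqP -[e2].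
    by have := a_neq_b ea eb; rewrite e2 eqxx.
  exists S' => //; split=> //; rewrite sw; apply/esym.
  by apply: (swap_nested ag' ea eb nz ez nw ew); rewrite e.
case: (ag) => /andP [i0 iN] _.
have [a Na ea'] : exists2 a : V, n < a & i = a - n by apply: vertex_of; rewrite i0 ltnW.
have [b Nb eb'] : exists2 b : V, n < b & i.+1 = b - n by apply: vertex_of.
have ea : a = n + i :> nat by rewrite ea' subnKC // ltnW.
have eb : b = n + i.+1 :> nat by rewrite eb' subnKC // ltnW.
exists (Ordinal iN); apply/existsP; exists a; apply/existsP; exists b.
apply/and5P; split=> //=.
- by rewrite i0 subn1 -ltnS prednK // (leq_trans _ iN).
- by rewrite /label ea addn1 addSn.
- by rewrite /label eb !addn1 addSn addnS.
- have [ab|nab] := boolP (a \in children T b); last first.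
    by rewrite (swap_disjoint ag ea eb) ?eqxx // eq_sym.
  apply/orP; right; rewrite /=.
  have [w [nw ew]] := children_other ab.
  have [z0 [z1 [nz ez]]] := children_internal T Na.
  have m1 := merges_a ag ea nz ez; have m2 := merges_b eb nw ew.
  have wb : w \in children T b :\ a by rewrite in_setD1 eq_sym nw ew !inE eqxx orbT.
  rewrite (leaf_set_internal Na ez) in m2; rewrite eq_sym in ne.
  have yz := ltW (step_lt (step_b ag)).
  apply/exists_inP; exists w => //; apply/exists_inP.
  have [m3|m3] := diamond_nested_other m1 m2 (step_a ag) yz ne.
    exists z1; first by rewrite ez !inE eqxx orbT.
    rewrite eq_sym in nz; rewrite setUC in ez.
    by rewrite (swap_nested ag ea eb nz ez nw ew m3).
  exists z0; first by rewrite ez !inE eqxx.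
  by rewrite (swap_nested ag ea eb nz ez nw ew m3).
- by rewrite (max_min_leavesE T Na) (max_min_leavesE T Nb) -ea' -eb'.
Qed.

End Moves.

(** * Inversions and the cover relations *)

Section Graded.
Context (V : finType) (e : rel V) (r : V -> nat).
Hypothesis er : forall x y, e x y -> r y = (r x).+1.

Lemma connect_head x y : connect e x y -> x = y \/ exists2 z, e x z & connect e z y.
Proof.
case/connectP => -[|z s] /=; first by left.
by case/andP => xz zs ->; right; exists z => //; apply/connectP; exists s.
Qed.

Lemma connect_rank x y : connect e x y -> r x <= r y.
Proof.
move=> xy; apply: (connect_ind (Q := fun z => r x <= r z) _ _ xy) => // a b xa /er ->.
exact: leqW.
Qed.

Lemma connect_rank_lt x y : connect e x y -> x != y -> r x < r y.
Proof.
case/connect_head => [->|[z /er xz /connect_rank]]; first by rewrite eqxx.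
by rewrite xz.
Qed.

Lemma graded_partial_order : partial_order (connect e).
Proof.
split; [exact: connect0| |exact: connect_trans].
move=> x y /andP [xy yx]; apply: contraTeq (connect_rank yx) => ne.
by rewrite -ltnNge connect_rank_lt.
Qed.

(** Anything strictly between the ends of an edge would have a rank strictly
    between two consecutive numbers. *)
Lemma graded_covers x y : covers (connect e) x y = e x y.
Proof.
apply/and3P/idP => [[ne xy /forallP no]|xy].
  case: (connect_head xy) => [exy|[z xz zy]]; first by rewrite exy eqxx in ne.
  have := no z; rewrite (connect1 xz) zy /= => /orP [/eqP ez|/eqP <- //].
  by have := er xz; rewrite ez => /eqP; rewrite -[X in X == _]addn0 -addn1 eqn_add2l.
have rxy := er xy; split; last 1 first.
- apply/forallP => z; apply/implyP => /andP [xz zy]; apply: contraT.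
  rewrite negb_or => /andP [zx zy']; rewrite eq_sym in zx.
  have := leq_ltn_trans (connect_rank_lt xz zx) (connect_rank_lt zy zy').
  by rewrite rxy ltnn.
- by apply: contraPneq rxy => -> /eqP; rewrite -[X in X == _]addn0 -addn1 eqn_add2l.
- exact: connect1.
Qed.

End Graded.

Lemma connect_iso (V W : finType) (e : rel V) (e' : rel W) (c : V -> W) :
  bijective c -> (forall x y, e' (c x) (c y) = e x y) ->
  forall x y, connect e' (c x) (c y) = connect e x y.
Proof.
case=> g cg gc ee' x y; apply/idP/idP => h.
  rewrite -(cg y); apply: (connect_ind (Q := fun m => connect e x (g m)) _ _ h).
    by move=> a b xa ab; apply: connect_trans xa _; apply: connect1; rewrite -ee' !gc.
  by rewrite cg connect0.
apply: (connect_ind (Q := fun z => connect e' (c x) (c z)) _ _ h) => [a b xa ab|]; last first.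
  exact: connect0.
by apply: connect_trans xa _; apply: connect1; rewrite ee'.
Qed.

Section Inversions.
Context (n : nat).
Local Notation SP := (set_partition 'I_n.+1).
Implicit Types (m : max_chain SP).

Definition label_at m (j : nat) := max_min (stage m j) (stage m j.+1).

Definition inversions m : {set 'I_n * 'I_n} :=
  [set jk : 'I_n * 'I_n | (jk.1 < jk.2) && (label_at m jk.2 < label_at m jk.1)].

(** The positions are shifted by one: the edges below and above stage i are the
    entries i - 1 and i of the word of labels. *)
Lemma chain_move_labels m m' i : chain_move m m' i -> forall i0 i1 : 'I_n,
  i0.+1 = i -> i1 = i :> nat -> forall j : 'I_n, label_at m' j = label_at m (tperm i0 i1 j).
Proof.
case=> /andP [ip iN] ag ne lt i0 i1 e0 e1.
have s1 : step (stage m i.-1) (stage m i).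
  by have := @stage_step n m i.-1; rewrite prednK //; apply; apply: ltnW.
have s2 := stage_step m iN.
have s3 : step (stage m' i.-1) (stage m' i).
  by have := @stage_step n m' i.-1; rewrite prednK //; apply; apply: ltnW.
have s4 := stage_step m' iN.
have p : i.-1 = i0 by rewrite -e0.
have agx : stage m' i.-1 = stage m i.-1.
  apply/esym/ag; first by apply: leq_trans (leq_pred i) (ltnW iN).
  by rewrite p -e0 neq_ltn leqnn.
have agz : stage m' i.+1 = stage m i.+1 by apply/esym/ag; rewrite // neq_ltn leqnn orbT.
have [l1 l2] : label_at m' i.-1 = label_at m i /\ label_at m' i = label_at m i.-1.
  rewrite /label_at prednK // agx agz; rewrite agx in s3; rewrite agz in s4.
  case: (label_swap s1 s2 s3 s4) => -[h1 h2]; last by rewrite h1 h2.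
  case/eqP: ne; apply: (ascending_unique s1 s2 s3 s4 (ltnW lt)).
  by rewrite -h1 -h2 ltnW.
move=> j; case: tpermP => [->|->|j0 j1].
- by rewrite -p l1 e1.
- by rewrite e1 l2 p.
have ji : j != i :> nat by apply/eqP => e; apply: j1; apply: val_inj; rewrite /= e1.
have ji' : j.+1 != i by apply/eqP => e; apply: j0; apply: val_inj; rewrite /=; case: e0 e => <- [].
by rewrite /label_at -!ag // ltnW.
Qed.

Lemma tperm_adjacent_lt (i0 i1 j k : 'I_n) : i1 = i0.+1 :> nat ->
  (j, k) != (i0, i1) -> (j, k) != (i1, i0) ->
  (tperm i0 i1 j < tperm i0 i1 k) = (j < k).
Proof.
have conv (x y : 'I_n) : x <> y -> x <> y :> nat by move=> ne /val_inj.
move=> e; rewrite !xpair_eqE -!(inj_eq val_inj) /=.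
by case: (tpermP i0 i1 j) => [->|->|/conv j0 /conv j1];
  case: (tpermP i0 i1 k) => [->|->|/conv k0 /conv k1]; move: e; clear conv; lia.
Qed.

(** Exchanging the adjacent entries permutes the pairs of positions and keeps
    their order, except for the pair of the exchanged entries itself. *)
Lemma inversions_move m m' i : chain_move m m' i -> #|inversions m'| = #|inversions m|.+1.
Proof.
move=> mv; have := chain_move_labels mv; case: mv => /andP [ip iN] _ _ lt lab.
have i0N : i.-1 < n by apply: leq_ltn_trans (leq_pred i) iN.
pose i0 := Ordinal i0N; pose i1 := Ordinal iN.
have {}lab := lab i0 i1 (prednK ip) erefl.
have e01 : i1 = i0.+1 :> nat by rewrite /= prednK.
have lt01 : label_at m i0 < label_at m i1 by rewrite /label_at /= prednK.
pose f (jk : 'I_n * 'I_n) := (tperm i0 i1 jk.1, tperm i0 i1 jk.2).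
have finj : injective f by move=> [j k] [j' k'] [/perm_inj -> /perm_inj ->].
suff -> : inversions m' = (i0, i1) |: f @^-1: inversions m.
  rewrite cardsU1 card_preimset // !inE /f /= tpermL tpermR.
  by rewrite ltnNge e01 leqnSn.
apply/setP => -[j k]; rewrite !inE /= !lab.
have [[-> ->]|n1] := eqVneq (j, k) (i0, i1).
  by rewrite tpermL tpermR lt01 e01 ltnSn.
have [[-> ->]|n2] := eqVneq (j, k) (i1, i0).
  by rewrite tpermL tpermR [label_at m i1 < _]ltnNge (ltnW lt01) !andbF.
by rewrite /= tperm_adjacent_lt.
Qed.

End Inversions.

(** The stages determine the leaf set of each vertex, as the block born there,
    and the leaf sets of its children, as the blocks that die there. *)
Lemma chain_of_tree_inj n : injective (@chain_of_tree n).
Proof.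
move=> T S e.
have st k : k <= n -> tree_stage T k = tree_stage S k by move=> kn; rewrite -(stage_tree T kn) -(stage_tree S kn) e.
have lvE u : leaf_set S u = leaf_set T u.
  have [/leafP [j ->]|nu] := leqP u n; first by rewrite !leaf_set_leaf.
  apply: set1_inj; rewrite -(tree_stage_born S nu) -!st ?tree_stage_born ?birth_le //.
  exact: leq_trans (leq_pred _) (birth_le u).
apply: val_inj; apply/ffunP => v /=; apply: option_eqP => u.
have [un|nu] := leqP u n; first by rewrite !no_parent_leaf.
rewrite -!leaf_set_children lvE -!tree_stage_dead // !st ?birth_le //.
exact: leq_trans (leq_pred _) (birth_le u).
Qed.

Lemma chain_of_tree_surj n (m : max_chain (set_partition 'I_n.+1)) :
  exists T, chain_of_tree T = m.
Proof.
exists (tree_of_seq (stage0 m) (@stage_step n m)); apply: stage_inj => j jn.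
by rewrite stage_tree // tree_of_seq_stage.
Qed.

Lemma chain_of_tree_bij n : bijective (@chain_of_tree n).
Proof.
have inv m : exists T, chain_of_tree T == m :> max_chain (set_partition 'I_n.+1).
  by have [T <-] := chain_of_tree_surj m; exists T.
exists (fun m => xchoose (inv m)) => [T|m]; last exact: (eqP (xchooseP (inv m))).
by apply: chain_of_tree_inj; apply: (eqP (xchooseP (inv _))).
Qed.

Lemma polygon_tree_move n (T S : PT n) :
  polygon_move (@max_min n.+1) (chain_of_tree T) (chain_of_tree S) = tree_move T S.
Proof.
apply/polygon_moveP/tree_moveP => -[i h]; exists i; exact/chain_move_tree.
Qed.

Theorem theorem6p28 (n : nat) :
  (exists c : PT n -> max_chain (set_partition 'I_n.+1),
     (forall T : PT n, chain_set (c T) = tree_chain T) /\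
     poset_isomorphism (@PT_order n) (descent_order (@max_min n.+1)) c) /\
  (forall T S : PT n, covers (@PT_order n) T S <-> tree_move T S).
Proof.
have rk (m m' : max_chain (set_partition 'I_n.+1)) :
    polygon_move (@max_min n.+1) m m' -> #|inversions m'| = #|inversions m|.+1.
  by case/polygon_moveP => i /inversions_move.
have rkT (T S : PT n) : tree_move T S ->
    #|inversions (chain_of_tree S)| = #|inversions (chain_of_tree T)|.+1.
  by rewrite -polygon_tree_move => /rk.
split; last by move=> T S; rewrite (graded_covers rkT).
exists (@chain_of_tree n); split=> //; split.
- exact: graded_partial_order rkT.
- exact: graded_partial_order rk.
- exact: chain_of_tree_bij.
- exact: connect_iso (@chain_of_tree_bij n) (@polygon_tree_move n).
Qed.
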